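(* Let $(W,S,L)$ be a standard finite Coxeter system not of type ${}^2F_4$, let $\Lambda=\mathrm{Irr}(\mathbb QW)$, $s=|\Lambda|$, and let $A^{+\natural}$, the ideals $J_i^\natural$, and the left $A^{+\natural}$-modules $\Delta(E)$ ($E\in\Lambda$) be as in the context. Let $$0=I_0\subseteq I_1\subseteq\cdots\subseteq I_s=A^{+\natural}$$ be a chain of ideals refining $0=J_0^\natural\subseteq\cdots\subseteq J_m^\natural=A^{+\natural}$ such that for every $1\le j\le s$, with $B'=A^{+\natural}/I_{j-1}$ and $J'=I_j/I_{j-1}$: $J'$ is a heredity ideal of $B'$ with $\mathrm{End}_{B'}(J')$ Morita equivalent to $\mathcal Z^\natural$; $J'=B'eB'$ for an idempotent $e\in B'$; and $J'\cong\Delta(E)^{\oplus l_j}\cong\Delta(E)\otimes_{\mathcal Z^\natural}\mathrm{Hom}_{B'}(\Delta(E),B')$ for some $E\in\Lambda$ and $l_j>0$ (such a chain exists). Then, for each $j$, there exists an idempotent $e_1\in B'$ such that $B'e_1\cong\Delta(E)$ as left $B'$-modules.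
   Context: ''Finite module'' means finitely generated module. An ideal $J$ of an algebra $B$, finite projective over a commutative Noetherian ring $\mathscr K$, is a heredity ideal if $B/J$ is $\mathscr K$-projective, ${}_BJ$ is $B$-projective, $J^2=J$, and $\mathrm{End}_B({}_BJ)$ is $\mathscr K$-semisimple (semisimple after base change to each residue field of $\mathscr K$). Coxeter system and Hecke algebra. $\mathcal Z=\mathbb Z[t,t^{-1}]$, $K=\mathbb Q(t)$. $(W,S,L)$ is a standard finite Coxeter system: there are a simple algebraic group $\mathbf G$ over an algebraically closed field of characteristic $p>0$ and a Frobenius map $F$ (an endomorphism some power of which is a standard Frobenius map), inducing a permutation $\rho$ of the Dynkin diagram, such that, with $(\mathbf W,\mathbf S)$ the Weyl group of $\mathbf G$ relative to an $F$-stable maximal torus in an $F$-stable Borel subgroup, $W=\mathbf W^F$, $S$ is the set of longest elements of the parabolic subgroups of $\mathbf W$ attached to the $\rho$-orbits on $\mathbf S$, and $L(w)$ is the length of $w\in W$ in $\mathbf W$; moreover $|S|\ge2$. Type ${}^2F_4$ is the case where $W$ is dihedral of order 16. $\mathcal H$ is the $\mathcal Z$-algebra with basis $\{T_w\}_{w\in W}$ and relations $T_sT_w=T_{sw}$ if $sw>w$, $T_sT_w=t^{2L(s)}T_{sw}+(t^{2L(s)}-1)T_w$ if $sw<w$ ($s\in S$). Put $\widetilde T_w=t^{-L(w)}T_w$. The bar involution is the ring involution with $t\mapsto t^{-1}$, $T_w\mapsto (T_{w^{-1}})^{-1}$. $\mathsf c_w=\sum_{y\le w}p_{y,w}\widetilde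 T_y$ is the unique bar-invariant element with $p_{w,w}=1$, $p_{y,w}\in t^{-1}\mathbb Z[t^{-1}]$ for $y<w$; write $\mathsf c_x\mathsf c_y=\sum_zh_{x,y,z}\mathsf c_z$. The preorder $\le_L$ on $W$ is the reflexive-transitive closure of: $y\le_L w$ if $\mathsf c_y$ occurs with nonzero coefficient in $\mathsf c_s\mathsf c_w$ for some $s\in S$; $x\le_R y$ iff $x^{-1}\le_L y^{-1}$; $\le_{LR}$ is the preorder generated by $\le_L,\le_R$. Left (two-sided) cells are the equivalence classes of $\le_L$ ($\le_{LR}$); $\Omega$ is the set of left cells, with induced relations. For $\omega\in\Omega$, $w\in\omega$: $S(\omega)=\sum_{y\le_L w}\mathcal Z\mathsf c_y\big/\sum_{y<_L w}\mathcal Z\mathsf c_y$ and $S_\omega=\mathrm{Hom}_{\mathcal Z}(S(\omega),\mathcal Z)$ (a right $\mathcal H$-module). For $J\subseteq S$, $W_J=\langle J\rangle$, $w_{0,J}$ is its longest element, $x_J=\sum_{w\in W_J}T_w$; each left cell contains at most one $w_{0,J}$. Bad primes. For an irreducible character $\chi$ of $\mathcal H_K$ the generic degree $D_\chi=\chi(1)\big(\sum_wt^{2L(w)}\big)\big/\sum_wt^{-2L(w)}\chi(T_w)\chi(T_{w^{-1}})$ has the form $\frac1m t^a\times$ (product of cyclotomic polynomials), $m$ a positive integer; the bad primes are those dividing some $m$. $\mathcal Z^\natural$ is the localization of $\mathcal Z$ inverting the bad primes; superscript $\natural$ denotes $\mathcal Z^\natural\otimes_{\mathcal Z}-$. Heights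 and exact categories. Fix $\mathfrak h:\Omega\to\mathbb Z_{>0}$ with $\omega<_{LR}\omega'\Rightarrow\mathfrak h(\omega)>\mathfrak h(\omega')$ and $\omega\sim_{LR}\omega'\Rightarrow\mathfrak h(\omega)=\mathfrak h(\omega')$. An irreducible right $\mathcal H_K$-module has height $\mathfrak h(\omega)$ if it occurs in $(S_\omega)_K$ (well defined). For a finite, $\mathcal Z$-torsion-free right $\mathcal H$-module $M$, $M^h$ is the intersection of $M$ with the sum of all irreducible submodules of $M_K$ of height $\le h$. $\mathscr A$ is the full subcategory of such $M$ for which every $M^h/M^{h-1}$ is isomorphic to a finite direct sum of modules $S_\omega$ with $\mathfrak h(\omega)=h$. $\mathscr E$ consists of the short exact sequences $0\to M\to N\to P\to0$ with terms in $\mathscr A$ such that $0\to M^h/M^{h-1}\to N^h/N^{h-1}\to P^h/P^{h-1}\to0$ is split exact for all $h$. For $M\in\mathscr A$ let $M^*=\mathrm{Hom}_{\mathcal Z}(M,\mathcal Z)$, $M^*_h=\{f\in M^*: f(M^h)=0\}$. For a left $\mathcal H$-module $V$ and $J\subseteq S$, $V^{\mathcal H_J}=\{v\in V: T_sv=t^{2L(s)}v\ \forall s\in J\}$. $\mathscr A_\flat$: those $M\in\mathscr A$ with $(M^*_{h-1})^{\mathcal H_J}\to(M^*_{h-1}/M^*_h)^{\mathcal H_J}$ surjective for all $h$, $J$. $\mathscr E_\flat$: sequences $0\to M\to N\to P\to 0$ in $\mathscr E$ with terms in $\mathscr A_\flat$ and $0\to(P^*_h)^{\mathcal H_J}\to(N^*_h)^{\mathcal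 H_J}\to(M^*_h)^{\mathcal H_J}\to0$ exact for all $h$, $J$. $(\mathscr A_\flat,\mathscr E_\flat)$ is an exact category; $\mathrm{Ext}^1_{\mathscr E_\flat}(Y,Z)$ classifies sequences $0\to Z\to E\to Y\to0$ in $\mathscr E_\flat$; an inflation is the first map of a sequence in $\mathscr E_\flat$. The algebra and ideals. $\Omega'\subseteq\Omega$: left cells containing no $w_{0,J}$. For $\omega\in\Omega'$, $X_\omega\in\mathscr A_\flat$ is a chosen object with an inflation $S_\omega\to X_\omega$ inducing $S_\omega\cong X_\omega^{\mathfrak h(\omega)}$ and $\mathrm{Ext}^1_{\mathscr E_\flat}(S_\tau,X_\omega)=0$ for all $\tau\in\Omega$ (these exist). $T^+_\omega=X_\omega$ for $\omega\in\Omega'$, $T^+_\omega=x_J\mathcal H$ if $w_{0,J}\in\omega$; $T^+=\bigoplus_{\omega\in\Omega}T^+_\omega$, $A^+=\mathrm{End}_{\mathcal H}(T^+)$, $P(\omega)=\mathrm{Hom}_{\mathcal H}(T^+_\omega,T^+)$. Let $j(1)>\cdots>j(m)$ be the values of $\mathfrak h$ on $\Omega$. $J_i$ is the ideal of $A^+$ equal to the sum of the images of all $A^+$-homomorphisms $P(\mu)\to A^+$ with $\mathfrak h(\mu)\ge j(i)$; $J_0=0$. The modules $\Delta(E)$. $a(z)$ is the least non-negative integer with $t^{a(z)}h_{x,y,z}\in\mathbb Z[t]$ for all $x,y$. Lusztig's asymptotic ring $\mathsf J$ has $\mathbb Z$-basis $\mathsf j_x$ ($x\in W$) and $\mathsf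 j_x\mathsf j_y=\sum_z\gamma_{x,y,z^{-1}}\mathsf j_z$, with $\gamma_{x,y,z^{-1}}$ the coefficient of $t^{a(z)}$ in $h_{x,y,z}$. Write $p_{1,z}=n_zt^{-\delta(z)}+$ lower powers, $n_z\ne0$; $\mathcal D=\{d: a(d)=\delta(d)\}$; $\hat n_z=n_d$ for the unique $d\in\mathcal D$ with $d\sim_Lz^{-1}$. $\varpi:\mathcal H\to\mathcal J=\mathcal Z\otimes\mathsf J$, $\varpi(\mathsf c_w)=\sum_{z}\sum_{d\in\mathcal D,a(d)=a(z)}h_{w,d,z}\hat n_z\mathsf j_z$, is an injective algebra homomorphism, an isomorphism over $\mathbb Q(t)$; its specialization at $t=1$ gives $\mathbb QW\cong\mathsf J_{\mathbb Q}$, so each $E\in\Lambda$ gives an irreducible $\mathcal J_{\mathbb Q(t)}$-module $E_{\mathbb Q(t)}$. $E_\natural$ is the (unique up to isomorphism) $\mathcal J^\natural$-lattice in $E_{\mathbb Q(t)}$ that is projective over $\mathcal Z^\natural$; $S^\natural(E)$ is its restriction to $\mathcal H^\natural$ through $\varpi^\natural$; $S^\natural_E=\mathrm{Hom}_{\mathcal Z^\natural}(S^\natural(E),\mathcal Z^\natural)$; $\Delta(E)=\mathrm{Hom}_{\mathcal H^\natural}(S^\natural_E,T^{+\natural})$. *)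

(* Defs.v *)
From HB Require Import structures.
From mathcomp Require Import all_boot all_order all_algebra all_fingroup.
From mathcomp Require Import all_solvable all_field all_character.
From mathcomp Require Import boolp generic_quotient.

Set Implicit Arguments.
Unset Strict Implicit.
Unset Printing Implicit Defensive.

Import GRing.Theory.
Local Open Scope ring_scope.
Local Open Scope quotient_scope.

Section Get.
Variables (T : Type) (x0 : T) (P : T -> Prop).
Definition get : T :=
  if pselect (exists x, P x) is left h then projT1 (cid h) else x0.
End Get.

Section Hom.
Variables (R : pzRingType) (M N : lmodType R).

Definition Hom : Type := {linear M -> N}.

HB.instance Definition _ := gen_eqMixin Hom.
HB.instance Definition _ := gen_choiceMixin Hom.

Lemma HomP (f g : Hom) : (f : M -> N) =1 g -> f = g.
Proof.
case: f => f cf; case: g => g cg /= efg.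
have {}efg : f = g by apply: funext.
case: _ / efg cg => cg; congr GRing.Linear.Pack.
case: cf cg => [[[f0 fD]] [fZ]] [[[g0 gD]] [gZ]].
by rewrite (Prop_irrelevance f0 g0) (Prop_irrelevance fD gD)
  (Prop_irrelevance fZ gZ).
Qed.

End Hom.
Section HomZmod.
Variables (R : pzRingType) (M N : lmodType R).
Local Notation Hom := (Hom M N).

Definition hom_zero : Hom := \0.
Definition hom_add (f g : Hom) : Hom := f \+ g.
Definition hom_opp (f : Hom) : Hom := \- f.

Lemma hom_addA : associative hom_add.
Proof. by move=> f g h; apply: HomP => x /=; rewrite addrA. Qed.
Lemma hom_addC : commutative hom_add.
Proof. by move=> f g; apply: HomP => x /=; rewrite addrC. Qed.
Lemma hom_add0 : left_id hom_zero hom_add.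
Proof. by move=> f; apply: HomP => x /=; rewrite add0r. Qed.
Lemma hom_addN : left_inverse hom_zero hom_opp hom_add.
Proof. by move=> f; apply: HomP => x /=; rewrite addNr. Qed.

HB.instance Definition _ :=
  GRing.isZmodule.Build Hom hom_addA hom_addC hom_add0 hom_addN.

End HomZmod.

Section End_.
Variables (R : pzRingType) (M : lmodType R).

Definition End : Type := Hom M M.
HB.instance Definition _ := GRing.Zmodule.on End.

Definition end_one : End := idfun.
Definition end_mul (f g : End) : End := f \o g.

Lemma end_mulA : associative end_mul.
Proof. by move=> f g h; apply: HomP. Qed.
Lemma end_mul1f : left_id end_one end_mul.
Proof. by move=> f; apply: HomP. Qed.
Lemma end_mulf1 : right_id end_one end_mul.
Proof. by move=> f; apply: HomP. Qed.
Lemma end_mulDl : left_distributive end_mul +%R.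
Proof. by move=> f g h; apply: HomP. Qed.
Lemma end_mulDr : right_distributive end_mul +%R.
Proof. by move=> f g h; apply: HomP => x /=; rewrite linearD. Qed.

HB.instance Definition _ := GRing.Zmodule_isPzRing.Build End
  end_mulA end_mul1f end_mulf1 end_mulDl end_mulDr.

End End_.

(** [Hom M N] as a left module over [End N], by post-composition. *)
Section HomL.
Variables (R : pzRingType) (M N : lmodType R).

Definition HomL : Type := Hom M N.
HB.instance Definition _ := GRing.Zmodule.on HomL.

Definition homL_scale (a : End N) (f : HomL) : HomL := a \o f.

Lemma homL_scaleA a b f : homL_scale a (homL_scale b f) = homL_scale (a * b) f.
Proof. exact: HomP. Qed.
Lemma homL_scale1 : left_id 1 homL_scale.
Proof. by move=> f; apply: HomP. Qed.
Lemma homL_scaleDr : right_distributive homL_scale +%R.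
Proof. by move=> a f g; apply: HomP => x /=; rewrite linearD. Qed.
Lemma homL_scaleDl f : {morph homL_scale^~ f : a b / a + b}.
Proof. by move=> a b; apply: HomP. Qed.

HB.instance Definition _ := GRing.Zmodule_isLmodule.Build (End N) HomL
  homL_scaleA homL_scale1 homL_scaleDr homL_scaleDl.

End HomL.

Definition restr (R S : pzRingType) (f : {rmorphism R -> S}) (M : lmodType S) :
  Type := M.

Section Restr.
Variables (R S : pzRingType) (f : {rmorphism R -> S}) (M : lmodType S).
Local Notation restr := (restr f M).

HB.instance Definition _ := GRing.Zmodule.on restr.

Definition restr_scale (r : R) (x : restr) : restr := f r *: (x : M).

Lemma restr_scaleA a b x :
  restr_scale a (restr_scale b x) = restr_scale (a * b) x.
Proof. by rewrite /restr_scale rmorphM scalerA. Qed.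
Lemma restr_scale1 : left_id 1 restr_scale.
Proof. by move=> x; rewrite /restr_scale rmorph1 scale1r. Qed.
Lemma restr_scaleDr : right_distributive restr_scale +%R.
Proof. by move=> a x y; rewrite /restr_scale scalerDr. Qed.
Lemma restr_scaleDl x : {morph restr_scale^~ x : a b / a + b}.
Proof. by move=> a b; rewrite /restr_scale rmorphD scalerDl. Qed.

HB.instance Definition _ := GRing.Zmodule_isLmodule.Build R restr
  restr_scaleA restr_scale1 restr_scaleDr restr_scaleDl.

End Restr.

Section Gen.
Variables (R : pzRingType) (M : lmodType R).

Definition is_submod (X : M -> Prop) : Prop :=
  [/\ X 0, forall x y, X x -> X y -> X (x + y)
    & forall (a : R) x, X x -> X (a *: x)].

Definition gen (X : M -> Prop) : M -> Prop :=
  fun x => forall Y, is_submod Y -> (forall y, X y -> Y y) -> Y x.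

Lemma gen_submod X : is_submod (gen X).
Proof.
split=> [Y sY _|x y gx gy Y sY XY|a x gx Y sY XY]; case: (sY) => Y0 YD YZ //.
  by apply: YD; [apply: gx|apply: gy].
by apply: YZ; apply: gx.
Qed.

Definition gen_pred (X : M -> Prop) : {pred M} := fun x => `[< gen X x >].

Lemma gen_pred_closed X : submod_closed (gen_pred X).
Proof.
have [g0 gD gZ] := gen_submod X.
split=> [|a x y /asboolP gx /asboolP gy]; apply/asboolP; first exact: g0.
by apply: gD => //; apply: gZ.
Qed.
HB.instance Definition _ X := GRing.isSubmodClosed.Build R M (gen_pred X)
  (gen_pred_closed X).

End Gen.

(** Taking the submodule generated by [X] avoids carrying proofs that [X] is a
    submodule; when it is one, this is [X] itself.  The same applies to [quom] and,
    for two-sided ideals, to [quoA]. *)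
Section Subm.
Variables (R : pzRingType) (M : lmodType R) (X : M -> Prop).

Record subm : Type := Subm { subm_val : M; _ : subm_val \in gen_pred X }.
HB.instance Definition _ := [isSub for subm_val].
HB.instance Definition _ := [Choice of subm by <:].
HB.instance Definition _ := [SubChoice_isSubLmodule of subm by <:].

End Subm.

Section Quom.
Variables (R : pzRingType) (M : lmodType R) (X : M -> Prop).

Definition quom_rel (x y : M) : bool := x - y \in gen_pred X.

Lemma quom_refl : reflexive quom_rel.
Proof. by move=> x; rewrite /quom_rel subrr rpred0. Qed.
Lemma quom_sym : symmetric quom_rel.
Proof. by move=> x y; rewrite /quom_rel -rpredN opprB. Qed.
Lemma quom_trans : transitive quom_rel.
Proof.
by move=> y x z xy yz; rewrite /quom_rel -(subrKA y x) rpredD.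
Qed.

Definition quom_equiv := EquivRel quom_rel quom_refl quom_sym quom_trans.
Definition quom : Type := {eq_quot quom_equiv}.
HB.instance Definition _ := Choice.on quom.
HB.instance Definition _ := EqQuotient.on quom.

Definition quom_pi (x : M) : quom := \pi_({eq_quot quom_equiv}) x.

Lemma quom_piP x y : quom_pi x = quom_pi y <-> x - y \in gen_pred X.
Proof. by split=> [/eqmodP|h]; last apply/eqmodP. Qed.

Lemma quom_pi_repr x : quom_pi (repr x) = x.
Proof. exact: reprK. Qed.

Lemma quom_repr_pi x : repr (quom_pi x) - x \in gen_pred X.
Proof. by apply/quom_piP; rewrite quom_pi_repr. Qed.

Definition quom_add (x y : quom) := quom_pi (repr x + repr y).
Definition quom_opp (x : quom) := quom_pi (- repr x).
Definition quom_scale (a : R) (x : quom) := quom_pi (a *: repr x).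

Lemma quom_piD x y : quom_pi (x + y) = quom_add (quom_pi x) (quom_pi y).
Proof.
apply/esym/quom_piP; rewrite opprD addrACA.
by rewrite rpredD ?quom_repr_pi.
Qed.
Lemma quom_piN x : quom_pi (- x) = quom_opp (quom_pi x).
Proof. by apply/esym/quom_piP; rewrite -opprD rpredN quom_repr_pi. Qed.
Lemma quom_piZ a x : quom_pi (a *: x) = quom_scale a (quom_pi x).
Proof. by apply/esym/quom_piP; rewrite -scalerBr rpredZ ?quom_repr_pi. Qed.

Lemma quomP (P : quom -> Prop) : (forall x, P (quom_pi x)) -> forall x, P x.
Proof. by move=> h x; rewrite -(quom_pi_repr x). Qed.

Lemma quom_addA : associative quom_add.
Proof.
by elim/quomP=> x; elim/quomP=> y; elim/quomP=> z; rewrite -!quom_piD addrA.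
Qed.
Lemma quom_addC : commutative quom_add.
Proof. by elim/quomP=> x; elim/quomP=> y; rewrite -!quom_piD addrC. Qed.
Lemma quom_add0 : left_id (quom_pi 0) quom_add.
Proof. by elim/quomP=> x; rewrite -!quom_piD add0r. Qed.
Lemma quom_addN : left_inverse (quom_pi 0) quom_opp quom_add.
Proof. by elim/quomP=> x; rewrite -quom_piN -quom_piD addNr. Qed.

HB.instance Definition _ :=
  GRing.isZmodule.Build quom quom_addA quom_addC quom_add0 quom_addN.

Lemma quom_scaleA a b x : quom_scale a (quom_scale b x) = quom_scale (a * b) x.
Proof. by elim/quomP: x => x; rewrite -!quom_piZ scalerA. Qed.
Lemma quom_scale1 : left_id 1 quom_scale.
Proof. by elim/quomP=> x; rewrite -quom_piZ scale1r. Qed.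
Lemma quom_scaleDr : right_distributive quom_scale +%R.
Proof.
move=> a; elim/quomP=> x; elim/quomP=> y.
rewrite -[quom_pi x + _]quom_piD -!quom_piZ scalerDr.
exact: quom_piD.
Qed.
Lemma quom_scaleDl x : {morph quom_scale^~ x : a b / a + b}.
Proof.
by move=> a b; elim/quomP: x => x /=; rewrite -!quom_piZ scalerDl quom_piD.
Qed.

HB.instance Definition _ := GRing.Zmodule_isLmodule.Build R quom
  quom_scaleA quom_scale1 quom_scaleDr quom_scaleDl.

Lemma quom_pi_linear : linear quom_pi.
Proof. by move=> a x y; rewrite quom_piD quom_piZ. Qed.
HB.instance Definition _ :=
  GRing.isLinear.Build R M quom _ quom_pi quom_pi_linear.

End Quom.

Section Dsum.
Variables (R : pzRingType) (I : finType) (M : I -> lmodType R).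

Definition dsum : Type := forall i, M i.
HB.instance Definition _ := gen_eqMixin dsum.
HB.instance Definition _ := gen_choiceMixin dsum.

Definition dsum_zero : dsum := fun=> 0.
Definition dsum_add (x y : dsum) : dsum := fun i => x i + y i.
Definition dsum_opp (x : dsum) : dsum := fun i => - x i.
Definition dsum_scale (a : R) (x : dsum) : dsum := fun i => a *: x i.

Lemma dsum_addA : associative dsum_add.
Proof. by move=> x y z; apply: functional_extensionality_dep => i; apply: addrA. Qed.
Lemma dsum_addC : commutative dsum_add.
Proof. by move=> x y; apply: functional_extensionality_dep => i; apply: addrC. Qed.
Lemma dsum_add0 : left_id dsum_zero dsum_add.
Proof. by move=> x; apply: functional_extensionality_dep => i; apply: add0r. Qed.
Lemma dsum_addN : left_inverse dsum_zero dsum_opp dsum_add.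
Proof. by move=> x; apply: functional_extensionality_dep => i; apply: addNr. Qed.

HB.instance Definition _ :=
  GRing.isZmodule.Build dsum dsum_addA dsum_addC dsum_add0 dsum_addN.

Lemma dsum_scaleA a b x : dsum_scale a (dsum_scale b x) = dsum_scale (a * b) x.
Proof. by apply: functional_extensionality_dep => i; apply: scalerA. Qed.
Lemma dsum_scale1 : left_id 1 dsum_scale.
Proof. by move=> x; apply: functional_extensionality_dep => i; apply: scale1r. Qed.
Lemma dsum_scaleDr : right_distributive dsum_scale +%R.
Proof.
by move=> a x y; apply: functional_extensionality_dep => i; apply: scalerDr.
Qed.
Lemma dsum_scaleDl x : {morph dsum_scale^~ x : a b / a + b}.
Proof.
by move=> a b; apply: functional_extensionality_dep => i; apply: scalerDl.
Qed.

HB.instance Definition _ := GRing.Zmodule_isLmodule.Build R dsum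
  dsum_scaleA dsum_scale1 dsum_scaleDr dsum_scaleDl.

End Dsum.

(** Unlike [algType], this allows the zero ring. *)
Record ralg (R : comPzRingType) : Type := RAlg {
  ra_ring :> pzRingType;
  ra_map : {rmorphism R -> ra_ring};
  ra_central : forall r a, ra_map r * a = a * ra_map r
}.
Arguments ra_map {R} A : rename.
Arguments ra_central {R} A : rename.

Lemma ralg_of_alg_central (R : comNzRingType) (A : algType R) (r : R) (a : A) :
  in_alg A r * a = a * in_alg A r.
Proof. by rewrite /= -scalerAl -scalerAr mul1r mulr1. Qed.
Definition ralg_of_alg (R : comNzRingType) (A : algType R) : ralg R :=
  RAlg (@ralg_of_alg_central R A).

Lemma ralg_of_map_central (R R' : comPzRingType) (f : {rmorphism R -> R'}) r a :
  f r * a = a * f r.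
Proof. exact: mulrC. Qed.
Definition ralg_of_map (R R' : comPzRingType) (f : {rmorphism R -> R'}) : ralg R :=
  RAlg (ralg_of_map_central f).

Section OpEndAlgebra.
Variable R : comPzRingType.

Definition op_map (A : ralg R) (r : R) : A^c := ra_map A r.
Lemma op_map_zmod_morphism (A : ralg R) : zmod_morphism (op_map A).
Proof. exact: (raddfB (ra_map A)). Qed.
Lemma op_map_monoid_morphism (A : ralg R) : monoid_morphism (op_map A).
Proof.
split=> [|x y]; first exact: (rmorph1 (ra_map A)).
by rewrite /op_map mulrC rmorphM.
Qed.
HB.instance Definition _ (A : ralg R) := GRing.isZmodMorphism.Build R A^c
  (op_map A) (op_map_zmod_morphism A).
HB.instance Definition _ (A : ralg R) := GRing.isMonoidMorphism.Build R A^c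
  (op_map A) (op_map_monoid_morphism A).

Lemma op_map_central (A : ralg R) r (a : A^c) : op_map A r * a = a * op_map A r.
Proof. exact/esym/(ra_central A). Qed.
(** Right [A]-modules are left modules over [opA A]. *)
Definition opA (A : ralg R) : ralg R := RAlg (@op_map_central A).

Variables (A : ralg R) (M : lmodType A).

Definition homothety (r : R) (x : M) : M := ra_map A r *: x.
Lemma homothety_linear r : linear (homothety r).
Proof.
by move=> a x y; rewrite /homothety scalerDr !scalerA ra_central.
Qed.
HB.instance Definition _ r :=
  GRing.isLinear.Build A M M _ (homothety r) (homothety_linear r).

Definition end_map (r : R) : End M := homothety r.
Lemma end_map_zmod_morphism : zmod_morphism end_map.
Proof.
by move=> r s; apply: HomP => x; rewrite /= /homothety raddfB scalerBl.
Qed.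
Lemma end_map_monoid_morphism : monoid_morphism end_map.
Proof.
split=> [|r s]; apply: HomP => x; rewrite /= /homothety.
  by rewrite rmorph1 scale1r.
by rewrite rmorphM scalerA.
Qed.
HB.instance Definition _ :=
  GRing.isZmodMorphism.Build R (End M) end_map end_map_zmod_morphism.
HB.instance Definition _ :=
  GRing.isMonoidMorphism.Build R (End M) end_map end_map_monoid_morphism.

Lemma end_map_central r (f : End M) : end_map r * f = f * end_map r.
Proof. by apply: HomP => x; rewrite /= /homothety linearZ. Qed.
Definition endA : ralg R := RAlg end_map_central.

End OpEndAlgebra.

Section Underlying.
Variable R : comPzRingType.
Definition under (A : ralg R) (M : lmodType A) : lmodType R := restr (ra_map A) M.
Definition regA (A : ralg R) : lmodType A := (ra_ring A)^o.
Definition homR (A : ralg R) (M N : lmodType A) : lmodType R :=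
  restr (ra_map (endA N)) (HomL M N).
End Underlying.

(** The [R]-dual of a left [A]-module, as a right [A]-module. *)
Section Dual.
Variables (R : comPzRingType) (A : ralg R) (M : lmodType A).

Definition dual : Type := Hom (under M) R^o.
HB.instance Definition _ := GRing.Zmodule.on dual.

Definition dual_fun (a : A) (f : dual) (x : under M) : R^o :=
  f ((a *: (x : M)) : under M).
Lemma dual_fun_linear a f : linear (dual_fun a f).
Proof.
move=> r x y; rewrite /dual_fun.
have -> : a *: ((r *: x + y : under M) : M) =
    ra_map A r *: (a *: (x : M)) + a *: (y : M) :> M.
  rewrite -[r *: x + y]/(ra_map A r *: (x : M) + (y : M)) scalerDr.
  by rewrite !scalerA ra_central.
exact: (linearP f).
Qed.
HB.instance Definition _ a f :=
  GRing.isLinear.Build R (under M) R^o _ (dual_fun a f) (dual_fun_linear a f).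

Definition dual_scale (a : opA A) (f : dual) : dual := dual_fun (a : A) f.

Lemma dual_scaleA a b f : dual_scale a (dual_scale b f) = dual_scale (a * b) f.
Proof. by apply: HomP => x; rewrite /= /dual_fun /= /dual_fun scalerA. Qed.
Lemma dual_scale1 : left_id 1 dual_scale.
Proof. by move=> f; apply: HomP => x; rewrite /= /dual_fun scale1r. Qed.
Lemma dual_scaleDr : right_distributive dual_scale +%R.
Proof. by move=> a f g; apply: HomP. Qed.
Lemma dual_scaleDl f : {morph dual_scale^~ f : a b / a + b}.
Proof.
by move=> a b; apply: HomP => x; rewrite /= /dual_fun scalerDl raddfD.
Qed.

HB.instance Definition _ := GRing.Zmodule_isLmodule.Build (opA A) dual
  dual_scaleA dual_scale1 dual_scaleDr dual_scaleDl.

End Dual.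

(** [tens M N] is the tensor product over [R] of an [A]-module [M] and an
    [R]-module [N], with [A] acting on the left factor.  Elements are formal sums
    of pairs; two formal sums are identified when every balanced map takes the
    same value on them. *)
Section Tens.
Variables (R : comPzRingType) (A : ralg R) (M : lmodType A) (N : lmodType R).

Definition balanced (V : zmodType) (b : M -> N -> V) : Prop :=
  [/\ forall x y n, b (x + y) n = b x n + b y n,
      forall x m n, b x (m + n) = b x m + b x n
    & forall r x n, b (ra_map A r *: x) n = b x (r *: n)].

Definition tens_eval (V : zmodType) (b : M -> N -> V) (s : seq (M * N)) : V :=
  \sum_(u <- s) b u.1 u.2.

Definition tens_rel (s s' : seq (M * N)) : bool :=
  `[< forall (V : zmodType) (b : M -> N -> V),
        balanced b -> tens_eval b s = tens_eval b s' >].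

Lemma tens_refl : reflexive tens_rel.
Proof. by move=> s; apply/asboolP. Qed.
Lemma tens_sym : symmetric tens_rel.
Proof.
by move=> s s'; apply/asboolP/asboolP => h V b /h.
Qed.
Lemma tens_trans : transitive tens_rel.
Proof.
move=> s2 s1 s3 /asboolP h1 /asboolP h2; apply/asboolP => V b hb.
by rewrite h1 ?h2.
Qed.

Definition tens_equiv := EquivRel tens_rel tens_refl tens_sym tens_trans.
Definition tens : Type := {eq_quot tens_equiv}.
HB.instance Definition _ := Choice.on tens.
HB.instance Definition _ := EqQuotient.on tens.

Definition tens_pi (s : seq (M * N)) : tens := \pi_({eq_quot tens_equiv}) s.
Definition tpure (x : M) (n : N) : tens := tens_pi [:: (x, n)].
Definition tlift (V : zmodType) (b : M -> N -> V) (u : tens) : V :=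
  tens_eval b (repr u).

Lemma tens_piP s s' : tens_pi s = tens_pi s' <->
  forall (V : zmodType) (b : M -> N -> V),
    balanced b -> tens_eval b s = tens_eval b s'.
Proof. by split=> [/eqmodP/asboolP|h]; last apply/eqmodP/asboolP. Qed.

Lemma tens_repr u : tens_pi (repr u) = u.
Proof. exact: reprK. Qed.

Lemma tlift_pi (V : zmodType) (b : M -> N -> V) s :
  balanced b -> tlift b (tens_pi s) = tens_eval b s.
Proof. by move=> hb; apply: (tens_piP _ _).1 => //; apply: tens_repr. Qed.

Lemma tens_eval_cat (V : zmodType) (b : M -> N -> V) s s' :
  tens_eval b (s ++ s') = tens_eval b s + tens_eval b s'.
Proof. exact: big_cat. Qed.

Lemma balanced_sub (V : zmodType) (b : M -> N -> V) x y n :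
  balanced b -> b (x - y) n = b x n - b y n.
Proof. by case=> h _ _; apply/eqP; rewrite eq_sym subr_eq -h subrK. Qed.
Lemma balanced_opp (V : zmodType) (b : M -> N -> V) x n :
  balanced b -> b (- x) n = - b x n.
Proof.
move=> hb; have := balanced_sub x x n hb; rewrite !subrr => b0.
by rewrite -[- x]sub0r (balanced_sub _ _ _ hb) b0 sub0r.
Qed.

Definition tens_add (u v : tens) := tens_pi (repr u ++ repr v).
Definition tens_opp (u : tens) := tens_pi [seq (- x.1, x.2) | x <- repr u].
Definition tens_scale (a : A) (u : tens) :=
  tens_pi [seq (a *: x.1, x.2) | x <- repr u].

Lemma tens_eval_opp (V : zmodType) (b : M -> N -> V) s : balanced b ->
  tens_eval b [seq (- x.1, x.2) | x <- s] = - tens_eval b s.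
Proof.
move=> hb; rewrite /tens_eval big_map -sumrN; apply: eq_bigr => x _ /=.
exact: balanced_opp.
Qed.

Definition balanced_scale_fun (V : zmodType) (a : A) (b : M -> N -> V) x n :=
  b (a *: x) n.
Lemma balanced_scale (V : zmodType) (a : A) (b : M -> N -> V) :
  balanced b -> balanced (balanced_scale_fun a b).
Proof.
case=> h1 h2 h3; split=> [x y n|x m n|r x n]; rewrite /balanced_scale_fun //.
  by rewrite scalerDr h1.
by rewrite -h3 !scalerA ra_central.
Qed.

Lemma tens_eval_scale (V : zmodType) a (b : M -> N -> V) s :
  tens_eval b [seq (a *: x.1, x.2) | x <- s] =
    tens_eval (balanced_scale_fun a b) s.
Proof. exact: big_map. Qed.

Lemma tens_piD s s' : tens_pi (s ++ s') = tens_add (tens_pi s) (tens_pi s').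
Proof.
apply/tens_piP => V b hb; rewrite !tens_eval_cat.
by rewrite -!/(tlift b _) !tlift_pi.
Qed.
Lemma tens_piN s :
  tens_pi [seq (- x.1, x.2) | x <- s] = tens_opp (tens_pi s).
Proof.
by apply/tens_piP => V b hb; rewrite !tens_eval_opp // -!/(tlift b _) tlift_pi.
Qed.
Lemma tens_piZ a s :
  tens_pi [seq (a *: x.1, x.2) | x <- s] = tens_scale a (tens_pi s).
Proof.
apply/tens_piP => V b hb; rewrite !tens_eval_scale -[RHS]/(tlift _ _).
by rewrite tlift_pi //; apply: balanced_scale.
Qed.

Lemma tens_piE (P : tens -> Prop) : (forall s, P (tens_pi s)) -> forall u, P u.
Proof. by move=> h u; rewrite -(tens_repr u). Qed.

Lemma tens_addA : associative tens_add.
Proof.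
by elim/tens_piE=> x; elim/tens_piE=> y; elim/tens_piE=> z;
  rewrite -!tens_piD catA.
Qed.
Lemma tens_addC : commutative tens_add.
Proof.
elim/tens_piE=> x; elim/tens_piE=> y; rewrite -!tens_piD.
by apply/tens_piP => V b hb; rewrite !tens_eval_cat addrC.
Qed.
Lemma tens_add0 : left_id (tens_pi [::]) tens_add.
Proof. by elim/tens_piE=> x; rewrite -!tens_piD. Qed.
Lemma tens_addN : left_inverse (tens_pi [::]) tens_opp tens_add.
Proof.
elim/tens_piE=> x; rewrite -tens_piN -tens_piD; apply/tens_piP => V b hb.
by rewrite tens_eval_cat tens_eval_opp // addNr /tens_eval big_nil.
Qed.

HB.instance Definition _ :=
  GRing.isZmodule.Build tens tens_addA tens_addC tens_add0 tens_addN.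

Lemma tens_scaleA a b u : tens_scale a (tens_scale b u) = tens_scale (a * b) u.
Proof.
elim/tens_piE: u => s; rewrite -!tens_piZ -map_comp; congr tens_pi.
by apply: eq_map => x /=; rewrite scalerA.
Qed.
Lemma tens_scale1 : left_id 1 tens_scale.
Proof.
elim/tens_piE=> s; rewrite -!tens_piZ; congr tens_pi.
by rewrite -[RHS]map_id; apply: eq_map => -[x n] /=; rewrite scale1r.
Qed.
Lemma tens_scaleDr : right_distributive tens_scale +%R.
Proof.
move=> a; elim/tens_piE=> s; elim/tens_piE=> s'.
by rewrite -[tens_pi s + _]tens_piD -!tens_piZ map_cat; apply: tens_piD.
Qed.
Lemma tens_scaleDl u : {morph tens_scale^~ u : a b / a + b}.
Proof.
move=> a b; elim/tens_piE: u => s /=; rewrite -!tens_piZ.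
rewrite -[RHS]tens_piD; apply/tens_piP => V c hc.
rewrite tens_eval_cat /tens_eval !big_map -big_split /=.
by apply: eq_bigr => x _; case: hc => hc _ _; rewrite scalerDl hc.
Qed.

HB.instance Definition _ := GRing.Zmodule_isLmodule.Build A tens
  tens_scaleA tens_scale1 tens_scaleDr tens_scaleDl.

Lemma tens_ind (P : tens -> Prop) : P 0 -> (forall x n, P (tpure x n)) ->
  (forall u v, P u -> P v -> P (u + v)) -> forall u, P u.
Proof.
move=> P0 P1 PD; elim/tens_piE; elim=> [|[x n] s Ps]; first exact: P0.
by rewrite -cat1s tens_piD; apply: (PD _ _ (P1 x n) Ps).
Qed.

Lemma tpure_balanced : balanced tpure.
Proof.
split=> [x y n|x m n|r x n]; do ?rewrite -[RHS]tens_piD;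
  apply/tens_piP => V b [h1 h2 h3];
  by rewrite /tens_eval !(big_cons, big_nil) /= ?addr0 ?h1 ?h2 ?h3.
Qed.
Lemma tpureDl x y n : tpure (x + y) n = tpure x n + tpure y n.
Proof. by case: tpure_balanced. Qed.
Lemma tpureDr x m n : tpure x (m + n) = tpure x m + tpure x n.
Proof. by case: tpure_balanced. Qed.
Lemma tpure_map r x n : tpure (ra_map A r *: x) n = tpure x (r *: n).
Proof. by case: tpure_balanced. Qed.
Lemma tpureZ a x n : a *: tpure x n = tpure (a *: x) n.
Proof. by rewrite -[LHS]tens_piZ. Qed.

Section Lift.
Variables (V : zmodType) (b : M -> N -> V) (hb : balanced b).
Lemma tlift_pure x n : tlift b (tpure x n) = b x n.
Proof. by rewrite tlift_pi // /tens_eval big_seq1. Qed.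
Lemma tliftD u v : tlift b (u + v) = tlift b u + tlift b v.
Proof.
elim/tens_piE: u => s; elim/tens_piE: v => s'.
by rewrite -[tens_pi s + _]tens_piD !tlift_pi // tens_eval_cat.
Qed.
Lemma tlift0 : tlift b 0 = 0.
Proof. by apply: (addrI (tlift b 0)); rewrite -tliftD !addr0. Qed.
End Lift.

End Tens.

Section BaseChange.
Variables (R R' : comPzRingType) (f : {rmorphism R -> R'}).

Definition bcR (N : lmodType R) : lmodType R' :=
  (@tens R (ralg_of_map f) (R'^o) N : lmodType (ralg_of_map f)).

Section BcR.
Variable N : lmodType R.

Definition bpure (p : R') (n : N) : bcR N :=
  @tpure R (ralg_of_map f) (R'^o) N p n.
Lemma bpureDl p q n : bpure (p + q) n = bpure p n + bpure q n.
Proof. exact: tpureDl. Qed.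
Lemma bpureDr p m n : bpure p (m + n) = bpure p m + bpure p n.
Proof. exact: tpureDr. Qed.
Lemma bpure_map r p n : bpure (f r * p) n = bpure p (r *: n).
Proof. exact: (@tpure_map R (ralg_of_map f)). Qed.
Lemma bpureB p q n : bpure (p - q) n = bpure p n - bpure q n.
Proof. exact: (balanced_sub _ _ _ (tpure_balanced _ _)). Qed.
Lemma bc_ind (P : bcR N -> Prop) : P 0 -> (forall p n, P (bpure p n)) ->
  (forall u v, P u -> P v -> P (u + v)) -> forall u, P u.
Proof. exact: (@tens_ind R (ralg_of_map f) (R'^o) N P). Qed.

Section Blift.
Variables (V : zmodType) (b : R' -> N -> V).
Definition bbal : Prop :=
  [/\ forall p q n, b (p + q) n = b p n + b q n,
      forall p m n, b p (m + n) = b p m + b p n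
    & forall r p n, b (f r * p) n = b p (r *: n)].
Definition blift (u : bcR N) : V := @tlift R (ralg_of_map f) (R'^o) N V b u.
Hypothesis hb : bbal.
Lemma blift_pure p n : blift (bpure p n) = b p n.
Proof. exact: (@tlift_pure R (ralg_of_map f)). Qed.
Lemma bliftD u v : blift (u + v) = blift u + blift v.
Proof. exact: (@tliftD R (ralg_of_map f)). Qed.
Lemma blift0 : blift 0 = 0.
Proof. exact: (@tlift0 R (ralg_of_map f)). Qed.
End Blift.
End BcR.

Definition is_action (B : ralg R) (N : lmodType R) (al : B -> N -> N) : Prop :=
  [/\ forall a m n, al a (m + n) = al a m + al a n,
      forall a b n, al (a + b) n = al a n + al b n,
      forall n, al 1 n = n,
      forall a b n, al (a * b) n = al a (al b n)
    & forall r n, al (ra_map B r) n = r *: n].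

Section Action.
Variables (B : ralg R) (N : lmodType R) (al : B -> N -> N).
Hypothesis alP : is_action al.
Notation bA := (bcR (under (regA B))).
Notation bN := (bcR N).

Definition bc_act2 (p : R') (a : B) (q : R') (m : N) : bN :=
  bpure (p * q) (al a m).
Lemma bc_act2_balanced p a :
  @bbal N bN (bc_act2 p a).
Proof.
case: alP => al1 al2 al3 al4 al5.
split=> [x y n|x m n|r x n]; rewrite /bc_act2.
- by rewrite mulrDr bpureDl.
- by rewrite al1 bpureDr.
- rewrite mulrCA bpure_map; congr bpure.
  by rewrite -!al5 -!al4 ra_central.
Qed.

Definition bc_act1 (p : R') (a : under (regA B)) (u : bN) : bN :=
  blift (bc_act2 p (a : B)) u.
Lemma bc_act1_pure p a q m :
  bc_act1 p a (bpure q m) = bpure (p * q) (al a m).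
Proof. exact: (blift_pure (bc_act2_balanced p a)). Qed.
Lemma bc_act1D p a u v : bc_act1 p a (u + v) = bc_act1 p a u + bc_act1 p a v.
Proof. exact: (bliftD (bc_act2_balanced p a)). Qed.
Lemma bc_act1_0 p a : bc_act1 p a 0 = 0.
Proof. exact: (blift0 (bc_act2_balanced p a)). Qed.

Lemma bc_act1_balanced (u : bN) :
  @bbal (under (regA B)) bN (fun p a => bc_act1 p a u).
Proof.
case: alP => al1 al2 al3 al4 al5.
elim/bc_ind: u => [|q m|u v [u1 u2 u3] [v1 v2 v3]].
- by split=> *; rewrite !bc_act1_0 ?addr0.
- split=> [x y n|x a b|r x a]; rewrite !bc_act1_pure.
  + by rewrite mulrDl bpureDl.
  + by rewrite al2 bpureDr.
  + rewrite -mulrA bpure_map; congr bpure.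
    by rewrite -al5 -al4.
- split=> [x y n|x a b|r x a]; rewrite !bc_act1D.
  + by rewrite u1 v1 addrACA.
  + by rewrite u2 v2 addrACA.
  + by rewrite u3 v3.
Qed.

Definition bc_act (x : bA) (u : bN) : bN := blift (fun p a => bc_act1 p a u) x.

Lemma bc_act_pure p a q m :
  bc_act (bpure p a) (bpure q m) = bpure (p * q) (al a m).
Proof. by rewrite /bc_act (blift_pure (bc_act1_balanced _)) bc_act1_pure. Qed.
Lemma bc_actDl u : {morph bc_act^~ u : x y / x + y}.
Proof. by move=> x y; apply: (bliftD (bc_act1_balanced _)). Qed.
Lemma bc_act0u u : bc_act 0 u = 0.
Proof. exact: (blift0 (bc_act1_balanced _)). Qed.
Lemma bc_actDr : right_distributive bc_act +%R.
Proof.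
move=> x u v; elim/bc_ind: x => [|p a|x y hx hy].
- by rewrite !bc_act0u addr0.
- by rewrite /bc_act !(blift_pure (bc_act1_balanced _)) bc_act1D.
- by rewrite !bc_actDl hx hy addrACA.
Qed.
Lemma bc_actx0 x : bc_act x 0 = 0.
Proof. by apply: (addrI (bc_act x 0)); rewrite -bc_actDr !addr0. Qed.
Lemma bc_act1u : left_id (@bpure (under (regA B)) 1 (1 : B)) bc_act.
Proof.
case: alP => al1 al2 al3 al4 al5.
elim/bc_ind => [|q m|u v hu hv]; first exact: bc_actx0.
  by rewrite bc_act_pure mul1r al3.
by rewrite bc_actDr hu hv.
Qed.

End Action.

Definition mod_act (A : ralg R) (M : lmodType A) (a : A) (m : under M) : under M :=
  a *: (m : M).
Lemma mod_actP (A : ralg R) (M : lmodType A) : is_action (@mod_act A M).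
Proof.
split=> [a m n|a b n|n|a b n|r n] //; rewrite /mod_act.
- exact: (scalerDr a (m : M)).
- exact: (scalerDl (n : M) a b).
- exact: (scale1r (n : M)).
- exact/esym/(scalerA a b (n : M)).
Qed.

Definition bc_mul (A : ralg R) : bcR (under (regA A)) -> _ -> _ :=
  bc_act (@mod_act A (regA A)).

Lemma bc_actA (A : ralg R) (N : lmodType R) (al : A -> N -> N) :
  is_action al -> forall x y u,
  bc_act al x (bc_act al y u) = bc_act al (bc_mul x y) u.
Proof.
move=> alP x y u; have hA := mod_actP (regA A); rewrite /bc_mul.
elim/bc_ind: x => [|p a|x x' hx hx'].
- by rewrite !bc_act0u.
- elim/bc_ind: y => [|q b|y y' hy hy'].
  + by rewrite bc_act0u // !bc_actx0 // bc_act0u.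
  + elim/bc_ind: u => [|r m|u v hu hv].
    * by rewrite !bc_actx0.
    * rewrite !bc_act_pure // mulrA; congr bpure.
      by case: alP => _ _ _ ->.
    * by rewrite !bc_actDr // hu hv.
  + by rewrite bc_actDl // !bc_actDr // hy hy' bc_actDl.
- by rewrite !bc_actDl // hx hx'.
Qed.

Section BcRing.
Variable A : ralg R.
Definition bcT : Type := bcR (under (regA A)).
HB.instance Definition _ := GRing.Zmodule.on bcT.

Let hA := mod_actP (regA A).
Lemma bc_mulA : associative (@bc_mul A).
Proof. by move=> x y z; apply: bc_actA. Qed.
Lemma bc_mul1x : left_id (@bpure (under (regA A)) 1 (1 : A)) (@bc_mul A).
Proof. exact: bc_act1u. Qed.
Lemma bc_mulx1 : right_id (@bpure (under (regA A)) 1 (1 : A)) (@bc_mul A).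
Proof.
rewrite /bc_mul; elim/bc_ind => [|q m|u v hu hv]; first exact: bc_act0u.
  by rewrite bc_act_pure // mulr1; congr bpure; apply: mulr1.
by rewrite bc_actDl // hu hv.
Qed.
Lemma bc_mulDl : left_distributive (@bc_mul A) +%R.
Proof. by move=> x y z; apply: bc_actDl. Qed.
Lemma bc_mulDr : right_distributive (@bc_mul A) +%R.
Proof. exact: bc_actDr. Qed.
HB.instance Definition _ := GRing.Zmodule_isPzRing.Build bcT
  bc_mulA bc_mul1x bc_mulx1 bc_mulDl bc_mulDr.

Lemma bc_mul_pure p (a : A) q (b : A) :
  (@bpure (under (regA A)) p a : bcT) * (@bpure (under (regA A)) q b : bcT) =
  @bpure (under (regA A)) (p * q) (a * b).
Proof. exact: bc_act_pure. Qed.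

Definition bc_map (p : R') : bcT := @bpure (under (regA A)) p (1 : A).
Lemma bc_map_zmod_morphism : zmod_morphism bc_map.
Proof.
by move=> p q; rewrite /bc_map bpureB.
Qed.
Lemma bc_map_monoid_morphism : monoid_morphism bc_map.
Proof.
split=> // p q; apply/esym; rewrite [LHS]bc_mul_pure.
by congr bpure; apply: mulr1.
Qed.
HB.instance Definition _ :=
  GRing.isZmodMorphism.Build R' bcT bc_map bc_map_zmod_morphism.
HB.instance Definition _ :=
  GRing.isMonoidMorphism.Build R' bcT bc_map bc_map_monoid_morphism.

Lemma bc_map_central p (x : bcT) : bc_map p * x = x * bc_map p.
Proof.
elim/bc_ind: x => [|q a|x y hx hy]; first by rewrite mulr0 mul0r.
  rewrite [LHS]bc_mul_pure [RHS]bc_mul_pure [p * q]mulrC; congr bpure.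
  by rewrite [LHS]mul1r [RHS]mulr1.
by rewrite mulrDr mulrDl hx hy.
Qed.

Definition bcA : ralg R' := RAlg bc_map_central.

End BcRing.

Section BcMod.
Variables (A : ralg R) (M : lmodType A).
Definition bcM : Type := bcR (under M).
HB.instance Definition _ := GRing.Zmodule.on bcM.
HB.instance Definition _ := GRing.Zmodule_isLmodule.Build (bcA A) bcM
  (bc_actA (mod_actP M)) (bc_act1u (mod_actP M)) (bc_actDr (mod_actP M))
  (bc_actDl (mod_actP M)).
Definition bc_pure (p : R') (m : M) : bcM := bpure (p : R') (m : under M).
End BcMod.

Section BcMorph.
Variables (A B : ralg R) (g : {rmorphism A -> B}).
Hypothesis gR : forall r, g (ra_map A r) = ra_map B r.

Definition bc_rmorph2 (p : R') (a : under (regA A)) : bcA B :=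
  bc_pure (M := regA B) p (g a).
Lemma bc_rmorph2_balanced :
  @bbal (under (regA A)) (bcA B) bc_rmorph2.
Proof.
split=> [x y n|x m n|r x n]; rewrite /bc_rmorph2 /bc_pure.
- by rewrite bpureDl.
- by rewrite [g _](raddfD g) bpureDr.
- rewrite bpure_map; congr bpure.
  by rewrite -[r *: n]/(ra_map A r * (n : A)) rmorphM gR.
Qed.
Definition bc_rmorph (x : bcA A) : bcA B := blift bc_rmorph2 x.

Lemma bc_rmorphD x y : bc_rmorph (x + y) = bc_rmorph x + bc_rmorph y.
Proof. exact: (bliftD bc_rmorph2_balanced). Qed.
Lemma bc_rmorph0 : bc_rmorph 0 = 0.
Proof. exact: (blift0 bc_rmorph2_balanced). Qed.
Lemma bc_rmorph_pure p (a : A) :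
  bc_rmorph (bc_pure (M := regA A) p a) = bc_pure (M := regA B) p (g a).
Proof. exact: (blift_pure bc_rmorph2_balanced). Qed.

Lemma bc_rmorph_zmod_morphism : zmod_morphism bc_rmorph.
Proof.
move=> x y; apply: (addIr (bc_rmorph y)).
by rewrite -bc_rmorphD !subrK.
Qed.
Lemma bc_rmorph_monoid_morphism : monoid_morphism bc_rmorph.
Proof.
split; first by rewrite [LHS]bc_rmorph_pure rmorph1.
move=> x y; elim/bc_ind: x => [|p a|x x' hx hx'].
- by rewrite mul0r bc_rmorph0 mul0r.
- elim/bc_ind: y => [|q b|y y' hy hy'].
  + by rewrite mulr0 bc_rmorph0 mulr0.
  + rewrite [_ * _]bc_mul_pure !bc_rmorph_pure [RHS]bc_mul_pure.
    by congr bpure; apply: rmorphM.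
  + by rewrite mulrDr !bc_rmorphD mulrDr hy hy'.
- by rewrite mulrDl !bc_rmorphD mulrDl hx hx'.
Qed.
HB.instance Definition _ := GRing.isZmodMorphism.Build (bcA A) (bcA B)
  bc_rmorph bc_rmorph_zmod_morphism.
HB.instance Definition _ := GRing.isMonoidMorphism.Build (bcA A) (bcA B)
  bc_rmorph bc_rmorph_monoid_morphism.
Definition bc_ralg_map : {rmorphism bcA A -> bcA B} := bc_rmorph.
End BcMorph.

(** The identification of [R' (x) A^op] with [(R' (x) A)^op]. *)
Section BcOp.
Variable A : ralg R.

Definition bc_op2 (p : R') (a : under (regA (opA A))) : opA (bcA A) :=
  (bc_pure (M := regA A) p (a : A) : bcA A).
Lemma bc_op2_balanced : @bbal (under (regA (opA A))) (opA (bcA A)) bc_op2.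
Proof.
split=> [x y n|x m n|r x n]; rewrite /bc_op2 /bc_pure.
- by rewrite bpureDl.
- by rewrite bpureDr.
- rewrite bpure_map; congr bpure.
  by rewrite -[LHS]/(ra_map A r * (n : A)) ra_central.
Qed.
Definition bc_op (x : bcA (opA A)) : opA (bcA A) := blift bc_op2 x.

Lemma bc_opD x y : bc_op (x + y) = bc_op x + bc_op y.
Proof. exact: (bliftD bc_op2_balanced). Qed.
Lemma bc_op0 : bc_op 0 = 0.
Proof. exact: (blift0 bc_op2_balanced). Qed.
Lemma bc_op_pure p (a : A) : bc_op (bc_pure (M := regA (opA A)) p (a : opA A)) =
  (bc_pure (M := regA A) p a : bcA A).
Proof. exact: (blift_pure bc_op2_balanced). Qed.

Lemma bc_op_zmod_morphism : zmod_morphism bc_op.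
Proof.
move=> x y; apply: (addIr (bc_op y)).
by rewrite -bc_opD !subrK.
Qed.
Lemma bc_op_monoid_morphism : monoid_morphism bc_op.
Proof.
split; first by rewrite [LHS]bc_op_pure.
move=> x y; elim/bc_ind: x => [|p a|x x' hx hx'].
- by rewrite mul0r bc_op0 mul0r.
- elim/bc_ind: y => [|q b|y y' hy hy'].
  + by rewrite mulr0 bc_op0 mulr0.
  + rewrite [_ * _]bc_mul_pure !bc_op_pure.
    have -> : (bc_pure (M := regA A) p a : opA (bcA A)) *
        (bc_pure (M := regA A) q b : opA (bcA A)) =
        (bc_pure (M := regA A) q b : bcA A) *
        (bc_pure (M := regA A) p a : bcA A) by [].
    by rewrite [RHS]bc_mul_pure [q * p]mulrC.
  + by rewrite mulrDr !bc_opD mulrDr hy hy'.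
- by rewrite mulrDl !bc_opD mulrDl hx hx'.
Qed.
HB.instance Definition _ := GRing.isZmodMorphism.Build (bcA (opA A))
  (opA (bcA A)) bc_op bc_op_zmod_morphism.
HB.instance Definition _ := GRing.isMonoidMorphism.Build (bcA (opA A))
  (opA (bcA A)) bc_op bc_op_monoid_morphism.
End BcOp.

(** The natural morphism from [R' (x) End_A(M)] to the endomorphisms of
    [R' (x) M]. *)
Section BcEnd.
Variables (A : ralg R) (M : lmodType A).

Definition ev_act (g : endA M) (m : under M) : under M := (g : End M) (m : M).
Lemma ev_actP : is_action ev_act.
Proof. by split=> // g x y; apply: (raddfD (g : End M)). Qed.

Lemma bc_end_comm (g : bcA (endA M)) (x : bcA A) (u : bcM M) :
  bc_act ev_act g (x *: u) = x *: (bc_act ev_act g u : bcM M).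
Proof.
have hE := ev_actP; have hM := mod_actP M.
rewrite -![_ *: _]/(bc_act (@mod_act A M) _ _).
elim/bc_ind: g => [|p g|g g' hg hg'].
- by rewrite !bc_act0u // bc_actx0.
- elim/bc_ind: x => [|q a|x x' hx hx'].
  + by rewrite !bc_act0u // bc_actx0.
  + elim/bc_ind: u => [|r m|u v hu hv].
    * by rewrite !bc_actx0 // bc_actx0.
    * rewrite !bc_act_pure // mulrCA; congr bpure.
      exact: (linearZZ (g : {linear M -> M}) a (m : M)).
    * by rewrite !bc_actDr // hu hv.
  + by rewrite !bc_actDl // bc_actDr // hx hx'.
- by rewrite !bc_actDl // bc_actDr // hg hg'.
Qed.

Definition bc_end_fun (g : bcA (endA M)) (u : bcM M) : bcM M :=
  bc_act ev_act g u.
Lemma bc_end_fun_linear g : linear (bc_end_fun g).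
Proof.
by move=> a u v; rewrite /bc_end_fun bc_actDr ?bc_end_comm //; apply: ev_actP.
Qed.
HB.instance Definition _ g := GRing.isLinear.Build (bcA A) (bcM M) (bcM M) _
  (bc_end_fun g) (bc_end_fun_linear g).

Definition bc_end (g : bcA (endA M)) : End (bcM M) := bc_end_fun g.
Lemma bc_end_zmod_morphism : zmod_morphism bc_end.
Proof.
move=> x y; apply: (addIr (bc_end y)); rewrite subrK; apply: HomP => u.
by rewrite /= -[LHS](bc_actDl ev_actP) subrK.
Qed.
Lemma bc_end_monoid_morphism : monoid_morphism bc_end.
Proof.
split=> [|x y]; apply: HomP => u; first exact: (bc_act1u ev_actP).
exact/esym/(bc_actA ev_actP).
Qed.
HB.instance Definition _ := GRing.isZmodMorphism.Build (bcA (endA M))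
  (End (bcM M)) bc_end bc_end_zmod_morphism.
HB.instance Definition _ := GRing.isMonoidMorphism.Build (bcA (endA M))
  (End (bcM M)) bc_end bc_end_monoid_morphism.

End BcEnd.
End BaseChange.

Definition is_ideal (A : pzRingType) (I : A -> Prop) : Prop :=
  [/\ I 0, forall x y, I x -> I y -> I (x + y),
      forall a x, I x -> I (a * x) & forall a x, I x -> I (x * a)].

Definition igen (A : pzRingType) (I : A -> Prop) : A -> Prop :=
  fun x => forall Y, is_ideal Y -> (forall y, I y -> Y y) -> Y x.

Lemma igen_ideal (A : pzRingType) (I : A -> Prop) : is_ideal (igen I).
Proof.
split=> [Y sY _|x y gx gy Y sY IY|a x gx Y sY IY|a x gx Y sY IY];
  case: (sY) => Y0 YD YL YR //.
- by apply: YD; [apply: gx|apply: gy].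
- by apply: YL; apply: gx.
- by apply: YR; apply: gx.
Qed.

Section Quotient.
Variables (R : comPzRingType) (A : ralg R) (I : A -> Prop).

Definition quoT : Type := @quom A (regA A) (igen I).
HB.instance Definition _ := GRing.Zmodule.on quoT.
Definition quo_pi (x : A) : quoT := @quom_pi A (regA A) (igen I) x.

Lemma quo_piP x y : quo_pi x = quo_pi y <-> igen I (x - y).
Proof.
split=> [/quom_piP/asboolP h|h]; last first.
  by apply/quom_piP/asboolP => Y _; apply.
apply: h => //; have [h0 hD hL _] := igen_ideal I.
by split=> // a z; apply: hL.
Qed.

Lemma quo_piK x : quo_pi (repr (x : quoT)) = x.
Proof. exact: quom_pi_repr. Qed.
Lemma quo_ind (P : quoT -> Prop) : (forall x, P (quo_pi x)) -> forall x, P x.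
Proof. by move=> h x; rewrite -(quo_piK x). Qed.
Lemma quo_piD x y : quo_pi (x + y) = quo_pi x + quo_pi y.
Proof. exact: quom_piD. Qed.

Definition quo_mul (x y : quoT) : quoT :=
  quo_pi ((repr x : A) * (repr y : A)).

Lemma quo_piM (x y : A) : quo_pi (x * y) = quo_mul (quo_pi x) (quo_pi y).
Proof.
apply/esym/quo_piP.
have [h0 hD hL hR] := igen_ideal I.
set x' : A := repr (quo_pi x); set y' : A := repr (quo_pi y).
have hx : igen I (x' - x) by apply/quo_piP; rewrite quo_piK.
have hy : igen I (y' - y) by apply/quo_piP; rewrite quo_piK.
have -> : x' * y' - x * y = x' * (y' - y) + (x' - x) * y.
  by rewrite mulrBr mulrBl addrA subrK.
by apply: hD; [apply: hL|apply: hR].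
Qed.

Lemma quo_mulA : associative quo_mul.
Proof.
by elim/quo_ind=> x; elim/quo_ind=> y; elim/quo_ind=> z; rewrite -!quo_piM mulrA.
Qed.
Lemma quo_mul1x : left_id (quo_pi 1) quo_mul.
Proof. by elim/quo_ind=> x; rewrite -quo_piM mul1r. Qed.
Lemma quo_mulx1 : right_id (quo_pi 1) quo_mul.
Proof. by elim/quo_ind=> x; rewrite -quo_piM mulr1. Qed.
Lemma quo_mulDl : left_distributive quo_mul +%R.
Proof.
elim/quo_ind=> x; elim/quo_ind=> y; elim/quo_ind=> z.
by rewrite -quo_piD -!quo_piM mulrDl quo_piD.
Qed.
Lemma quo_mulDr : right_distributive quo_mul +%R.
Proof.
elim/quo_ind=> x; elim/quo_ind=> y; elim/quo_ind=> z.
by rewrite -quo_piD -!quo_piM mulrDr quo_piD.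
Qed.
HB.instance Definition _ := GRing.Zmodule_isPzRing.Build quoT
  quo_mulA quo_mul1x quo_mulx1 quo_mulDl quo_mulDr.

Lemma quo_pi_zmod_morphism : zmod_morphism quo_pi.
Proof. by move=> x y; apply: (addIr (quo_pi y)); rewrite -quo_piD !subrK. Qed.
Lemma quo_pi_monoid_morphism : monoid_morphism quo_pi.
Proof. by split=> // x y; apply: quo_piM. Qed.
HB.instance Definition _ :=
  GRing.isZmodMorphism.Build A quoT quo_pi quo_pi_zmod_morphism.
HB.instance Definition _ :=
  GRing.isMonoidMorphism.Build A quoT quo_pi quo_pi_monoid_morphism.

Lemma quo_central r (x : quoT) :
  (quo_pi \o ra_map A) r * x = x * (quo_pi \o ra_map A) r.
Proof.
by elim/quo_ind: x => x; rewrite /= -!(rmorphM quo_pi) ra_central.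
Qed.

Definition quoA : ralg R := RAlg quo_central.
End Quotient.

Section ModProps.
Variable A : pzRingType.

Definition lin_iso (M N : lmodType A) : Prop :=
  exists f : {linear M -> N}, bijective f.

Definition finite_module (M : lmodType A) : Prop :=
  exists s : seq M, forall x, gen (fun y => y \in s) x.

Definition projective (P : lmodType A) : Prop :=
  forall (M N : lmodType A) (g : {linear M -> N}) (h : {linear P -> N}),
  (forall y, exists x, g x = y) ->
  exists k : {linear P -> M}, forall x, g (k x) = h x.

Definition simple_submod (M : lmodType A) (X : M -> Prop) : Prop :=
  [/\ is_submod X, exists x, X x /\ x <> 0
    & forall Y : M -> Prop, is_submod Y -> (forall x, Y x -> X x) ->
      (forall x, Y x -> x = 0) \/ (forall x, X x -> Y x)].

Definition semisimple_ring : Prop :=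
  forall x : A^o,
  gen (fun y => exists X : A^o -> Prop, simple_submod X /\ X y) x.

End ModProps.

Definition short_exact (A : pzRingType) (M N P : lmodType A)
    (f : {linear M -> N}) (g : {linear N -> P}) : Prop :=
  [/\ injective f, forall y, g y = 0 <-> (exists x, f x = y)
    & forall z, exists y, g y = z].

Definition has_section (A : pzRingType) (N P : lmodType A)
    (g : {linear N -> P}) : Prop :=
  exists s : {linear P -> N}, forall z, g (s z) = z.

Definition morita_equivalent (A B : pzRingType) : Prop :=
  exists (F : lmodType A -> lmodType B)
    (Fm : forall M N : lmodType A, Hom M N -> Hom (F M) (F N)),
  [/\ forall M, Fm M M idfun = idfun,
      forall M N P (g : Hom N P) (h : Hom M N),
        Fm M P (g \o h) = Fm N P g \o Fm M N h,
      forall M N, bijective (Fm M N)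
    & forall N, exists M, lin_iso (F M) N].

(** The residue fields of [R] are the fields generated, as fields, by the image
    of a ring morphism from [R]: the kernel is the corresponding prime. *)
Definition residue_field (R : comPzRingType) (k : fieldType)
    (f : {rmorphism R -> k}) : Prop :=
  forall x : k, exists a b : R, f b != 0 /\ x = f a / f b.

Definition semisimple_over (R : comPzRingType) (C : ralg R) : Prop :=
  forall (k : fieldType) (f : {rmorphism R -> k}),
  residue_field f -> semisimple_ring (bcA f C).

Definition heredity_ideal (R : comPzRingType) (B : ralg R) (J : B -> Prop) :
  Prop :=
  [/\ finite_module (under (regA B)) /\ projective (under (regA B)),
      is_ideal J,
      projective (under (regA (quoA J))) /\ projective (@subm B (regA B) J),
      forall x, J x <-> igen (fun z => exists y y', [/\ J y, J y' & z = y * y']) x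
    & semisimple_over (endA (@subm B (regA B) J))].

Notation Qt := {fraction {poly rat}}.

Definition tK : Qt := tofrac 'X.
Definition ipolyK (q : {poly int}) : Qt := tofrac (map_poly intr q).

Lemma tK_neq0 : tK != 0.
Proof. by rewrite tofrac_eq0 polyX_eq0. Qed.

Lemma ipolyKD q r : ipolyK (q + r) = ipolyK q + ipolyK r.
Proof. by rewrite /ipolyK !rmorphD. Qed.
Lemma ipolyKN q : ipolyK (- q) = - ipolyK q.
Proof. by rewrite /ipolyK !rmorphN. Qed.
Lemma ipolyKM q r : ipolyK (q * r) = ipolyK q * ipolyK r.
Proof. by rewrite /ipolyK !rmorphM. Qed.
Lemma ipolyK1 : ipolyK 1 = 1.
Proof. by rewrite /ipolyK !rmorph1. Qed.
Lemma ipolyKXn n : ipolyK 'X^n = tK ^+ n.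
Proof. by rewrite /ipolyK !rmorphXn /= map_polyX. Qed.
Lemma ipolyKn n : ipolyK (n%:R) = n%:R.
Proof. by rewrite /ipolyK !rmorph_nat. Qed.

Definition laurent_rep (x : Qt) (qn : {poly int} * nat) : Prop :=
  x * tK ^+ qn.2 = ipolyK qn.1.
Definition laurent_pred : {pred Qt} := fun x => `[< exists qn, laurent_rep x qn >].

Lemma laurent_subring : subring_closed laurent_pred.
Proof.
split=> [|x y /asboolP[[q n] hq] /asboolP[[r m] hr]|
  x y /asboolP[[q n] hq] /asboolP[[r m] hr]]; apply/asboolP.
- by exists (1, 0%N); rewrite /laurent_rep ipolyK1 mulr1.
- exists (q * 'X^m - r * 'X^n, (n + m)%N); rewrite /laurent_rep /= in hq hr *.
  rewrite ipolyKD ipolyKN !ipolyKM !ipolyKXn -hq -hr exprD mulrBl !mulrA.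
  by rewrite [y * _ * _]mulrAC.
- exists (q * r, (n + m)%N); rewrite /laurent_rep /= in hq hr *.
  by rewrite ipolyKM -hq -hr exprD mulrACA.
Qed.
HB.instance Definition _ :=
  GRing.isSubringClosed.Build Qt laurent_pred laurent_subring.

(** [Zt] is Z[t, t^-1], as a subring of Q(t). *)
Record Zt : Type := MkZt { Zt_val : Qt; _ : Zt_val \in laurent_pred }.
HB.instance Definition _ := [isSub for Zt_val].
HB.instance Definition _ := [Choice of Zt by <:].
HB.instance Definition _ := [SubChoice_isSubComNzRing of Zt by <:].

Lemma tZ_subproof : tK \in laurent_pred.
Proof.
apply/asboolP; exists ('X, 0%N).
by rewrite /laurent_rep mulr1 -[X in ipolyK X]expr1 ipolyKXn.
Qed.
Lemma tiZ_subproof : tK^-1 \in laurent_pred.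
Proof.
by apply/asboolP; exists (1, 1%N); rewrite /laurent_rep ipolyK1 mulVf ?tK_neq0.
Qed.
Definition tZ : Zt := MkZt tZ_subproof.
Definition tiZ : Zt := MkZt tiZ_subproof.
Definition tpow (k : int) : Zt :=
  match k with Posz n => tZ ^+ n | Negz n => tiZ ^+ n.+1 end.

(** An expression of a Laurent polynomial as q(t) / t^n. *)
Definition laurent_pair (x : Zt) : {poly int} * nat :=
  get (0, 0%N) (laurent_rep (Zt_val x)).
Definition lcoef (x : Zt) (k : int) : int :=
  let qn := laurent_pair x in
  match k + qn.2%:Z with Posz i => qn.1`_i | Negz _ => 0 end.
Definition lval1 (x : Zt) : int := (laurent_pair x).1.[1].

Section Localization.
Variable bad : nat -> Prop.

Definition bad_nat (N : nat) : Prop :=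
  (0 < N)%N /\ forall q, prime q -> (q %| N)%N -> bad q.
Definition loc_pred : {pred Qt} :=
  fun x => `[< exists N, bad_nat N /\ x * N%:R \in laurent_pred >].

Lemma bad_natM N N' : bad_nat N -> bad_nat N' -> bad_nat (N * N').
Proof.
move=> [N0 hN] [N'0 hN']; split; first by rewrite muln_gt0 N0.
by move=> q pq; rewrite Euclid_dvdM // => /orP[/hN|/hN']; apply.
Qed.

Lemma loc_subring : subring_closed loc_pred.
Proof.
split=> [|x y /asboolP[N [bN xN]] /asboolP[N' [bN' yN']]|
  x y /asboolP[N [bN xN]] /asboolP[N' [bN' yN']]]; apply/asboolP.
- exists 1%N; split; last by rewrite mulr1 rpred1.
  by split=> // q pq; rewrite dvdn1 => /eqP q1; rewrite q1 in pq.
- exists (N * N')%N; split; first exact: bad_natM.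
  rewrite natrM mulrBl mulrA [y * (_ * _)]mulrCA [N%:R * _]mulrC.
  by rewrite rpredB // rpredM // rpred_nat.
- exists (N * N')%N; split; first exact: bad_natM.
  by rewrite natrM mulrACA rpredM.
Qed.
HB.instance Definition _ :=
  GRing.isSubringClosed.Build Qt loc_pred loc_subring.

(** The localization of Z[t, t^-1] inverting the primes in [bad]. *)
Record Zloc : Type := MkZloc { Zloc_val : Qt; _ : Zloc_val \in loc_pred }.
HB.instance Definition _ := [isSub for Zloc_val].
HB.instance Definition _ := [Choice of Zloc by <:].
HB.instance Definition _ := [SubChoice_isSubComNzRing of Zloc by <:].

Lemma Zt_loc_subproof (x : Zt) : Zt_val x \in loc_pred.
Proof.
apply/asboolP; exists 1%N; split; last by rewrite mulr1; case: x.
by split=> // q pq; rewrite dvdn1 => /eqP q1; rewrite q1 in pq.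
Qed.
Definition Zt_loc (x : Zt) : Zloc := MkZloc (Zt_loc_subproof x).
Lemma Zt_loc_zmod_morphism : zmod_morphism Zt_loc.
Proof. by move=> x y; apply: val_inj. Qed.
Lemma Zt_loc_monoid_morphism : monoid_morphism Zt_loc.
Proof. by split=> [|x y]; apply: val_inj. Qed.
HB.instance Definition _ :=
  GRing.isZmodMorphism.Build Zt Zloc Zt_loc Zt_loc_zmod_morphism.
HB.instance Definition _ :=
  GRing.isMonoidMorphism.Build Zt Zloc Zt_loc Zt_loc_monoid_morphism.

End Localization.

Definition Zt_frac : {rmorphism Zt -> Qt} := val : Zt -> Qt.
Definition int_Zt : {rmorphism int -> Zt} := intr : int -> Zt.

Section Length.
Variables (gT : finGroupType) (S : {set gT}).
Implicit Types (w y : gT) (J : {set gT}).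

(** Length of [w] in the group generated by [S]: the least [n] such that [w] is a
    product of [n] elements of [S]; such [n] are smaller than #|gT|. *)
Definition len w : nat := find (fun n => w \in (S ^+ n)%g) (iota 0 #|gT|).

Definition longest J w : bool :=
  (w \in <<J>>%g) && [forall y in <<J>>%g, (len y <= len w)%N].

(** [s ^ g] ranges over the reflections of W. *)
Definition bruhat_step y w : bool :=
  [exists s in S, exists g : gT, w == (s ^ g * y)%g] && (len y < len w)%N.
Definition bruhat_le : rel gT := connect bruhat_step.
Definition bruhat_lt y w : bool := bruhat_le y w && (y != w).
End Length.

(** Linear algebraic groups over [k] are presented as Zariski-closed subgroups of
    GL_n(k); regular functions on them are polynomials in the entries divided by
    powers of the determinant. *)
Section AlgebraicGroups.
Variables (p : nat) (k : closedFieldType).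
Section Fixed_n.
Variable n : nat.
Local Notation Mn := 'M[k]_n.
Implicit Types (G H B T : Mn -> Prop) (F : Mn -> Mn).

Inductive polyfun : (Mn -> k) -> Prop :=
| polyfun_const c : polyfun (fun=> c)
| polyfun_coord i j : polyfun (fun g => g i j)
| polyfun_add u v : polyfun u -> polyfun v -> polyfun (fun g => u g + v g)
| polyfun_mul u v : polyfun u -> polyfun v -> polyfun (fun g => u g * v g).

Definition zclosed G : Prop :=
  exists I : (Mn -> k) -> Prop, (forall u, I u -> polyfun u) /\
  forall g, G g <-> g \in unitmx /\ forall u, I u -> u g = 0.

Definition gl_subgroup G : Prop :=
  [/\ forall g, G g -> g \in unitmx, G 1%:M,
      forall g h, G g -> G h -> G (g *m h) & forall g, G g -> G (invmx g)].

Definition closed_subgroup G : Prop := gl_subgroup G /\ zclosed G.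

Definition zconnected G : Prop :=
  forall C D : Mn -> Prop, zclosed C -> zclosed D ->
  (forall g, G g -> C g \/ D g) -> (forall g, ~ [/\ G g, C g & D g]) ->
  (forall g, G g -> C g) \/ (forall g, G g -> D g).

Definition subgroup_le H G : Prop := forall g, H g -> G g.
Definition normal_subgroup H G : Prop :=
  subgroup_le H G /\ forall g h, G g -> H h -> H (g *m h *m invmx g).

(** Simple in the sense of algebraic groups: the centre may be finite. *)
Definition simple_group G : Prop :=
  [/\ closed_subgroup G, zconnected G,
      exists g h, [/\ G g, G h & g *m h <> h *m g]
    & forall H, closed_subgroup H -> zconnected H -> normal_subgroup H G ->
      (forall h, H h -> h = 1%:M) \/ subgroup_le G H].

Definition solvable_group G : Prop :=
  exists (r : nat) (D : nat -> Mn -> Prop),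
  [/\ forall g, D 0%N g <-> G g, forall g, D r g -> g = 1%:M,
      forall i, gl_subgroup (D i)
    & forall i g h, D i g -> D i h ->
      D i.+1 (g *m h *m invmx g *m invmx h)].

Definition borel_like G B : Prop :=
  [/\ closed_subgroup B, zconnected B, solvable_group B & subgroup_le B G].
Definition borel_subgroup G B : Prop :=
  borel_like G B /\
  forall B', borel_like G B' -> subgroup_le B B' -> subgroup_le B' B.

Definition torus_in G T : Prop :=
  [/\ closed_subgroup T, zconnected T, subgroup_le T G
    & exists2 x : Mn, x \in unitmx &
      forall g, T g -> is_diag_mx (x *m g *m invmx x)].
Definition maximal_torus G T : Prop :=
  torus_in G T /\
  forall T', torus_in G T' -> subgroup_le T T' -> subgroup_le T' T.

Definition normalizer G T : Mn -> Prop :=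
  fun g => G g /\ forall x, T (g *m x *m invmx g) <-> T x.

Definition stable F T : Prop := forall y, T y <-> exists2 x, T x & y = F x.

(** The simple reflections of the Weyl group, relative to the Borel subgroup [B],
    are the non-trivial classes of elements [g] such that the union of [B] and
    [BgB] is a subgroup. *)
Definition rank_one B (g : Mn) : Prop :=
  gl_subgroup (fun x => B x \/ exists b b', [/\ B b, B b' & x = b *m g *m b']).
End Fixed_n.

Definition alg_morphism n m (G : 'M[k]_n -> Prop) (f : 'M[k]_n -> 'M[k]_m) :
  Prop :=
  [/\ forall g, G g -> f g \in unitmx,
      forall g h, G g -> G h -> f (g *m h) = f g *m f h
    & forall i j, exists (u : 'M[k]_n -> k) (e : nat), polyfun u /\
      forall g, G g -> f g i j = u g / (\det g) ^+ e].

Definition standard_frobenius n (G : 'M[k]_n -> Prop) (F : 'M[k]_n -> 'M[k]_n) :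
  Prop :=
  exists (e m : nat) (i : 'M[k]_n -> 'M[k]_m),
  [/\ (0 < e)%N, alg_morphism G i,
      forall g h, G g -> G h -> i g = i h -> g = h
    & forall g, G g -> i (F g) = map_mx (fun x => x ^+ (p ^ e)) (i g)].

Definition frobenius_map n (G : 'M[k]_n -> Prop) (F : 'M[k]_n -> 'M[k]_n) :
  Prop :=
  [/\ alg_morphism G F, forall g, G g -> G (F g)
    & exists2 m, (0 < m)%N & standard_frobenius G (iter m F)].
End AlgebraicGroups.

(** In the definition below, [pi] identifies [WW] with the Weyl group N_G(T)/T,
    [SS] is its set of simple reflections relative to [B], [FW] is the action of
    the Frobenius map on [WW] (it permutes [SS]), and [io] identifies [gT] with the
    fixed points of [FW]. *)
Definition standard_coxeter (gT : finGroupType) (S : {set gT}) (L : gT -> nat) :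
  Prop :=
  (2 <= #|S|)%N /\
  exists (p : nat) (k : closedFieldType) (n : nat) (G T B : 'M[k]_n -> Prop)
    (F : 'M[k]_n -> 'M[k]_n) (WW : finGroupType) (pi : 'M[k]_n -> WW)
    (SS : {set WW}) (FW : WW -> WW) (io : gT -> WW),
  let N := normalizer G T in
  [/\ [/\ p \in [pchar k], simple_group G & frobenius_map p G F],
      [/\ borel_subgroup G B, maximal_torus G T, subgroup_le T B,
          stable F B & stable F T],
      [/\ forall g h, N g -> N h -> pi (g *m h) = (pi g * pi h)%g,
          forall w, exists2 g, N g & pi g = w,
          forall g, N g -> (pi g = 1%g <-> T g),
          forall w, w \in SS <-> w != 1%g /\
            exists g, [/\ N g, pi g = w & rank_one B g]
        & forall g, N g -> FW (pi g) = pi (F g)],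
      [/\ injective io, forall x y, io (x * y)%g = (io x * io y)%g
        & forall w, FW w = w <-> exists x, w = io x]
    & (forall x, x \in S <-> exists2 s, s \in SS &
          longest SS [set r | fconnect FW s r] (io x)) /\
      (forall x, L x = len SS (io x))].

(** [klc] is the Kazhdan-Lusztig basis c_w, [klp] are the coefficients p_{y,w} (only
    meaningful for y <= w) and [klh] the structure constants h_{x,y,z}.  These data
    are determined by (W, S, L), up to a unique isomorphism. *)
Record kl_data (gT : finGroupType) (S : {set gT}) (L : gT -> nat) : Type :=
KLData {
  hecke : algType Zt;
  hT : gT -> hecke;
  hT_basis : forall x, exists! a : {ffun gT -> Zt}, x = \sum_w a w *: hT w;
  hT_up : forall s w, s \in S -> bruhat_lt S w (s * w)%g ->
    hT s * hT w = hT (s * w)%g;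
  hT_down : forall s w, s \in S -> bruhat_lt S (s * w)%g w ->
    hT s * hT w = tpow (2 * L s)%N *: hT (s * w)%g
                  + (tpow (2 * L s)%N - 1) *: hT w;
  hbar : {rmorphism hecke -> hecke};
  hbarK : involutive hbar;
  hbar_t : hbar (tZ%:A) = tiZ%:A;
  hbar_T : forall w, hbar (hT w) * hT w^-1%g = 1 /\ hT w^-1%g * hbar (hT w) = 1;
  klp : gT -> gT -> Zt;
  klc : gT -> hecke;
  klcE : forall w, klc w =
    \sum_(y | bruhat_le S y w) klp y w *: (tpow (- (L y)%:Z) *: hT y);
  klc_bar : forall w, hbar (klc w) = klc w;
  klp_diag : forall w, klp w w = 1;
  klp_lt : forall y w, bruhat_lt S y w ->
    forall i : int, lcoef (klp y w) i != 0 -> (i < 0)%R;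
  klh : gT -> gT -> gT -> Zt;
  klhE : forall x y, klc x * klc y = \sum_z klh x y z *: klc z
}.

Section Cells.
Variables (gT : finGroupType) (S : {set gT}) (L : gT -> nat).
Variable D : kl_data S L.
Implicit Types (w : gT) (J : {set gT}).

(** Right modules over the Hecke algebra are modules over [RH]. *)
Definition HH : ralg Zt := ralg_of_alg (hecke D).
Definition RH : ralg Zt := opA HH.

Definition leL : rel gT :=
  connect (fun y w => [exists s in S, klh D s w y != 0]).
Definition leR : rel gT := fun x y => leL x^-1%g y^-1%g.
Definition leLR : rel gT := connect (fun x y => leL x y || leR x y).
Definition simL : rel gT := fun x y => leL x y && leL y x.

Definition lcells : {set {set gT}} := [set [set y | simL y w] | w in [set: gT]].
Definition cell : finType := {om : {set gT} | om \in lcells}.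
Implicit Types om tau : cell.

Definition cell_leLR om tau : bool :=
  [exists x in val om, exists y in val tau, leLR x y].
Definition below_cell (y : gT) om : bool := [exists w in val om, leL y w].

(** The left cell module S(om) and its dual S_om.  The spans of the c_y with
    y <=_L om, respectively y <_L om, are left ideals. *)
Definition Sspan om : regA HH -> Prop :=
  fun u => exists (a : Zt) (y : gT), below_cell y om /\ u = a *: klc D y :> hecke D.
Definition Smod om : lmodType HH :=
  @quom HH (subm (Sspan om)) (fun u => exists (a : Zt) (y : gT),
    [/\ below_cell y om, y \notin val om & val u = a *: klc D y :> hecke D]).
Definition Sdual om : lmodType RH := dual (Smod om).

Definition HK : ralg Qt := bcA Zt_frac HH.
Definition irr_rep d (r : {rmorphism HK -> 'M[Qt]_d}) : Prop :=
  [/\ (0 < d)%N, forall a : Qt, r (ra_map HK a) = a%:M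
    & forall U : 'M[Qt]_d, (forall h : HK, (U *m r h <= U)%MS) ->
      U = 0 \/ row_full U].

Definition chi d (r : {rmorphism HK -> 'M[Qt]_d}) w : Qt :=
  \tr (r (bc_pure (M := regA HH) Zt_frac 1 (hT D w))).
Definition generic_degree d (r : {rmorphism HK -> 'M[Qt]_d}) : Qt :=
  d%:R * (\sum_w tK ^+ (2 * L w)) /
  (\sum_w tK ^- (2 * L w) * chi r w * chi r w^-1%g).

Definition bad_prime (q : nat) : Prop :=
  prime q /\ exists d (r : {rmorphism HK -> 'M[Qt]_d}), irr_rep r /\
  exists (m : nat) (a : int) (ns : seq nat),
  [/\ (0 < m)%N, all (leq 1) ns,
      generic_degree r = m%:R^-1 * tK ^ a * \prod_(i <- ns) ipolyK 'Phi_i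
    & (q %| m)%N].

Definition Znat : comNzRingType := Zloc bad_prime.
Definition to_nat : {rmorphism Zt -> Znat} := @Zt_loc bad_prime.
Definition Hnat : ralg Znat := bcA to_nat HH.

Variable ht : cell -> nat.

Definition is_height : Prop :=
  [/\ forall om, (0 < ht om)%N,
      forall om tau, cell_leLR om tau -> ~~ cell_leLR tau om ->
        (ht tau < ht om)%N
    & forall om tau, cell_leLR om tau -> cell_leLR tau om -> ht om = ht tau].

Definition height_le (M : lmodType RH) (X : bcM Zt_frac M -> Prop) (h : nat) :
  Prop :=
  exists om, (ht om <= h)%N /\
  exists g : {linear (subm X) -> (bcM Zt_frac (Sdual om))}, injective g.

(** M^h.  An irreducible right H_K-module has height at most [h] when it embeds in
    some (S_om)_K with [ht om <= h]. *)
Definition hfilt (M : lmodType RH) (h : nat) : M -> Prop := fun m =>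
  gen (fun u : bcM Zt_frac M =>
         exists X, [/\ simple_submod X, height_le X h & X u])
      (bc_pure (M := M) Zt_frac 1 m).

(** M^h / M^(h-1), for h > 0. *)
Definition hgr (M : lmodType RH) (h : nat) : lmodType RH :=
  @quom RH (subm (@hfilt M h)) (fun u => hfilt h.-1 (val u)).

Definition torsion_free (M : lmodType RH) : Prop :=
  forall (a : Zt) (m : M), ra_map RH a *: m = 0 -> a = 0 \/ m = 0.

Definition in_A (M : lmodType RH) : Prop :=
  [/\ finite_module M, torsion_free M
    & forall h, (0 < h)%N -> exists n (om : 'I_n -> cell),
      (forall i, ht (om i) = h) /\
      lin_iso (hgr M h) (dsum (fun i => Sdual (om i)))].

Definition induces (M N : lmodType RH) (f : {linear M -> N}) (h : nat)
    (fh : {linear (hgr M h) -> (hgr N h)}) : Prop :=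
  forall (u : subm (@hfilt M h)) (v : subm (@hfilt N h)),
  val v = f (val u) -> fh (quom_pi _ u) = quom_pi _ v.

Definition in_E (M N P : lmodType RH) (f : {linear M -> N})
    (g : {linear N -> P}) : Prop :=
  [/\ [/\ in_A M, in_A N & in_A P], short_exact f g
    & forall h, (0 < h)%N ->
      exists (fh : {linear (hgr M h) -> (hgr N h)})
        (gh : {linear (hgr N h) -> (hgr P h)}),
      [/\ induces f fh, induces g gh, short_exact fh gh & has_section gh]].

(** M^*_h and H_J-invariants.  As M is an [RH]-module, the left H-module M^* is a
    module over the opposite of [RH]. *)
Definition annih (M : lmodType RH) (h : nat) : dual M -> Prop :=
  fun f => forall m, hfilt h m -> f m = 0.
Definition invariant (V : lmodType (opA RH)) J (v : V) : Prop :=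
  forall s, s \in J ->
  (hT D s : opA RH) *: v = ra_map (opA RH) (tpow (2 * L s)%N) *: v.

Definition in_Aflat (M : lmodType RH) : Prop :=
  in_A M /\ forall h J, (0 < h)%N -> J \subset S ->
  let V : lmodType (opA RH) := subm (@annih M h.-1) in
  let V1 : V -> Prop := fun u => annih h (val u) in
  forall v : quom V1, invariant J v -> exists u : V, invariant J u /\
    quom_pi V1 u = v.

Definition annih_inv (M : lmodType RH) (h : nat) J (u : dual M) : Prop :=
  annih h u /\ invariant J u.

Definition in_Eflat (M N P : lmodType RH) (f : {linear M -> N})
    (g : {linear N -> P}) : Prop :=
  [/\ in_E f g, [/\ in_Aflat M, in_Aflat N & in_Aflat P]
    & forall h J, J \subset S ->
      [/\ forall u : dual P, annih_inv h J u -> (forall y, u (g y) = 0) -> u = 0,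
          forall v : dual N, annih_inv h J v ->
            ((forall x, v (f x) = 0) <->
             exists2 u : dual P, annih_inv h J u & forall y, v y = u (g y))
        & forall w : dual M, annih_inv h J w ->
            exists2 v : dual N, annih_inv h J v & forall x, w x = v (f x)]].

Definition Ext1_zero (Y Z : lmodType RH) : Prop :=
  forall (E : lmodType RH) (f : {linear Z -> E}) (g : {linear E -> Y}),
  in_Eflat f g -> has_section g.

(** The subset J of S with w_{0,J} in the cell, if any. *)
Definition cell_J om : option {set gT} :=
  [pick J : {set gT} | (J \subset S) && [exists w in val om, longest S J w]].

Definition good_X om (X : lmodType RH) : Prop :=
  [/\ in_Aflat X,
      exists f : {linear (Sdual om) -> X},
        (exists (P : lmodType RH) (g : {linear X -> P}), in_Eflat f g) /\
        (forall x, hfilt (ht om) x <-> exists y, f y = x)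
    & forall tau, Ext1_zero (Sdual tau) X].

Definition xJ J : hecke D := \sum_(w in <<J>>%g) hT D w.

Variable X : cell -> lmodType RH.

Definition Tcell om : lmodType RH :=
  if cell_J om is Some J then @subm RH (regA RH) (fun u => u = xJ J)
  else X om.
Definition Tplus : lmodType RH := dsum Tcell.
Definition Aplus : ralg Zt := endA Tplus.
Definition Pmod om : lmodType Aplus := HomL (Tcell om) Tplus.

(** j(1) > ... > j(m). *)
Definition jvals : seq nat := sort geq (undup [seq ht om | om : cell]).
Definition Jideal (i : nat) : Aplus -> Prop :=
  if i is i'.+1 then
    gen (fun x : regA Aplus => exists mu, (nth 0%N jvals i' <= ht mu)%N /\
      exists (g : {linear (Pmod mu) -> (regA Aplus)}) y, x = g y)
  else fun x => x = 0.

(** A^{+nat}, and the image of Z^nat (x) J_i in it. *)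
Definition Anat : ralg Znat := bcA to_nat Aplus.
Definition Jideal_nat (i : nat) : Anat -> Prop := fun x =>
  exists s : seq (Znat * Aplus), (forall u, u \in s -> Jideal i u.2) /\
  x = \sum_(u <- s) bc_pure (M := regA Aplus) to_nat u.1 u.2.

Definition a_bound z (n : nat) : Prop :=
  forall x y (i : int), lcoef (tpow n * klh D x y z) i != 0 -> (0 <= i)%R.
Definition afun z : nat :=
  get 0%N (fun n => a_bound z n /\ forall n', a_bound z n' -> (n <= n')%N).
(** gamma_{x,y,z^-1}. *)
Definition gam x y z : int := lcoef (klh D x y z) (afun z).

Definition delta z : nat :=
  get 0%N (fun n => lcoef (klp D 1%g z) (- n%:Z) != 0 /\
    forall i : int, lcoef (klp D 1%g z) i != 0 -> (i <= - n%:Z)%R).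
Definition nlead z : int := lcoef (klp D 1%g z) (- (delta z)%:Z).
Definition Dset : {set gT} := [set d | afun d == delta d].
Definition nhat z : int :=
  nlead (get 1%g (fun d => d \in Dset /\ simL d z^-1%g)).

End Cells.

Record asymp_data (gT : finGroupType) (S : {set gT}) (L : gT -> nat)
    (D : kl_data S L) : Type := AsympData {
  JJ : algType int;
  jj : gT -> JJ;
  jj_basis : forall x, exists! a : {ffun gT -> int}, x = \sum_w a w *: jj w;
  jjM : forall x y, jj x * jj y = \sum_z gam D x y z *: jj z;
  varpi : {rmorphism HH D -> bcA int_Zt (ralg_of_alg JJ)};
  varpi_map : forall a, varpi (ra_map (HH D) a) = ra_map (bcA int_Zt (ralg_of_alg JJ)) a;
  varpiE : forall w, varpi (klc D w) =
    \sum_z \sum_(d in Dset D | afun D d == afun D z)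
      bc_pure (M := regA (ralg_of_alg JJ)) int_Zt
        (klh D w d z * (nhat D z)%:~R) (jj z)
}.

Section Delta.
Variables (gT : finGroupType) (S : {set gT}) (L : gT -> nat).
Variables (D : kl_data S L) (Y : asymp_data D).

Definition JZ : ralg Zt := bcA int_Zt (ralg_of_alg (JJ Y)).
Definition JZnat : ralg (Znat D) := bcA (to_nat D) JZ.
Definition varpi_nat : {rmorphism Hnat D -> JZnat} :=
  bc_ralg_map (to_nat D) (varpi_map Y).

(** [rho] is the restriction of [psi] along the specialization of varpi at t = 1,
    which sends the value of c_w at t = 1 (the left-hand side below, in QW) to the
    right-hand side.  Both act on column vectors, which makes them left modules. *)
Definition specializes d (rho : mx_representation rat [set: gT] d)
    (psi : {rmorphism JJ Y -> 'M[rat]_d}) : Prop :=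
  forall w, \sum_(y | bruhat_le S y w) (lval1 (klp D y w))%:~R *: rho y =
    \sum_z \sum_(d in Dset D | afun D d == afun D z)
      (lval1 (klh D w d z) * nhat D z)%:~R *: psi (jj Y z).

(** [E] is a lattice in E_{Q(t)}, which is the space of column vectors over Q(t)
    with the asymptotic ring acting through [psi]; [i] is the embedding. *)
Definition is_lattice d (rho : mx_representation rat [set: gT] d)
    (E : lmodType JZnat) : Prop :=
  exists (psi : {rmorphism JJ Y -> 'M[rat]_d}) (i : {additive E -> 'cV[Qt]_d}),
  [/\ specializes rho psi,
      [/\ injective i,
          forall (a : Znat D) v, i (ra_map JZnat a *: v) = val a *: i v
        & forall (x : JJ Y) v,
          i ((bc_pure (M := regA JZ) (to_nat D) 1
            (bc_pure (M := regA (ralg_of_alg (JJ Y))) int_Zt 1 x : JZ) : JZnat)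
             *: v) = map_mx ratr (psi x) *m i v],
      forall u, exists (a : Znat D) v, a != 0 /\ i v = val a *: u,
      finite_module E
    & projective (under E)].

Variables (X : cell D -> lmodType (RH D)) (E : lmodType JZnat).

Definition SE : lmodType (Hnat D) := restr varpi_nat E.
Definition SEdual : lmodType (bcA (to_nat D) (RH D)) :=
  restr (@bc_op _ _ (to_nat D) (HH D)) (dual SE).
Definition Delta : lmodType (Anat X) :=
  restr (@bc_end _ _ (to_nat D) (RH D) (Tplus X))
    (HomL SEdual (bcM (to_nat D) (Tplus X))).
End Delta.

Definition irr_family (gT : finGroupType) (s : nat) (d : 'I_s -> nat)
    (rho : forall i, mx_representation rat [set: gT] (d i)) : Prop :=
  [/\ forall i, mx_irreducible (rho i),
      forall i j, mx_rsim (rho i) (rho j) -> i = j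
    & forall e (r : mx_representation rat [set: gT] e), mx_irreducible r ->
      exists i, mx_rsim r (rho i)].

Section Chain.
Variables (R : comPzRingType) (A : ralg R) (I : nat -> A -> Prop).

(** For [0 < j]: B' = A / I_(j-1) and J' = I_j / I_(j-1). *)
Definition stepB (j : nat) : ralg R := quoA (I j.-1).
Definition stepJ (j : nat) : stepB j -> Prop :=
  fun y => exists2 x, I j x & y = quo_pi (I j.-1) x.
Definition infl (j : nat) (M : lmodType (stepB j)) : lmodType A :=
  restr (quo_pi (I j.-1) : {rmorphism A -> stepB j}) M.

(** The isomorphisms between J', Delta^l and Delta (x) Hom_B'(Delta, B') are
    isomorphisms of left B'-modules, expressed as isomorphisms of A-modules since
    Delta is given as an A-module. *)
Definition good_step (j l : nat) (De : lmodType A) : Prop :=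
  let B := stepB j in
  let J : lmodType B := subm (@stepJ j : regA B -> Prop) in
  [/\ heredity_ideal (@stepJ j),
      morita_equivalent (End J) R,
      exists e : B, e * e = e /\
        forall x, stepJ x <-> igen (fun y => y = e) x,
      (0 < l)%N /\ lin_iso (infl J) (dsum (fun _ : 'I_l => De))
    & lin_iso (infl J) (tens De (homR De (infl (regA B))))].

Definition ideal_chain (s : nat) : Prop :=
  [/\ forall j, (j <= s)%N -> is_ideal (I j),
      forall x, I 0%N x <-> x = 0, forall x, I s x
    & forall j x, (j < s)%N -> I j x -> I j.+1 x].
End Chain.

(* Main.v *)
Require Import Defs.
From HB Require Import structures.
From mathcomp Require Import all_boot all_order all_algebra all_fingroup.
From mathcomp Require Import all_solvable all_field all_character.
From mathcomp Require Import boolp generic_quotient.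

Set Implicit Arguments.
Unset Strict Implicit.
Unset Printing Implicit Defensive.

Import Order.TTheory GRing.Theory Num.Theory.
Local Open Scope ring_scope.

(** Write R = Z^nat, C = End(Delta) and N = Hom(Delta, B').  Comparing the ranks
    over R in J' = Delta^l = Delta (x)_R N, where N = Hom(Delta, J') = C^l, shows
    that C has rank 1, so that C = R unless Delta = 0.  Hence for phi in N and v in
    Delta there is <phi, v> in R such that phi(x) v = <phi, v> x for all x, and
    Delta is isomorphic to B' phi(v) as soon as <phi, v> = 1.  The isomorphism of J'
    with Delta^l gives e = sum_i phi_i(v_i), and then the matrix of the <phi_i, v_j>
    is idempotent and nonzero.  So one needs that a nonzero finite projective module
    over a localization of Z[t, t^-1] has a unimodular element.  This is proved by
    Seshadri's method: after splitting the idempotent over Q[t] and clearing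
    denominators one has matrices U and V with det(UV) = d t^j, and each prime q
    dividing d can be removed, because modulo q the rows of U or the columns of V
    become dependent, and row reduction over the Euclidean ring F_q[t] lifts. *)

(** * Unimodular elements over localizations of Z[t, t^-1] *)

(** The Euclidean algorithm on the entries of [x]: a division step is an elementary matrix, which
    lifts along [pi] because its quotient does. Each column operation on [x] is compensated by the
    inverse row operation on [U], so the relation persists until [x] has one nonzero entry. *)
Lemma clear_row (K : fieldType) (R : comNzRingType)
    (pi : {rmorphism R -> {poly K}}) (pi_surj : forall y, exists x, pi x = y)
    r n (U : 'M[R]_(r, n)) (x : 'rV[{poly K}]_r) :
  x != 0 -> x *m map_mx pi U = 0 ->
  exists (E E' : 'M[R]_r) (i : 'I_r),
    E' *m E = 1%:M /\ forall j, pi ((E *m U) i j) = 0.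
Proof.
have [k] := ubnP (\sum_i size (x 0%R i))%N; elim: k => // k IH in x U *.
move=> lek x0 xU.
case: (pickP (fun ij : 'I_r * 'I_r => [&& ij.1 != ij.2, x 0 ij.2 != 0 &
    (size (x 0%R ij.2) <= size (x 0%R ij.1))%N])) => [[i j] /= /and3P[ij xj szj]|one].
(* The image of [1 - D] replaces [x 0 i] by its remainder modulo [x 0 j], which lowers the sum of
   sizes; [1 + D] is the inverse of [1 - D]. *)
- have [a pia] := pi_surj (x 0 i %/ x 0 j).
  pose D : 'M[R]_r := a *: delta_mx j i.
  have DD : D *m D = 0.
    by rewrite -scalemxAl -scalemxAr mul_delta_mx_0 ?scaler0 // eq_sym eq_sym.
  have E0E : (1%:M - D) *m (1%:M + D) = 1%:M.
    by rewrite mulmxDr mulmx1 mulmxBl mul1mx DD subr0 subrK.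
  have xD k' : (x *m map_mx pi (1%:M - D)) 0 k' =
      if k' == i then x 0 i %% x 0 j else x 0 k'.
    rewrite map_mxB map_mx1 mulmxBr mulmx1 map_mxZ map_delta_mx -scalemxAr !mxE.
    rewrite (bigD1 j) //= !mxE eqxx big1 => [|l lj]; last first.
      by rewrite !mxE (negPf lj) mulr0.
    rewrite addr0 pia; have [->|_] := eqVneq k' i; last by rewrite !mulr0 subr0.
    by rewrite mulr1 {1}(divp_eq (x 0 i) (x 0 j)) addrC addKr.
  have [] := IH (x *m map_mx pi (1%:M - D)) ((1%:M + D) *m U).
  + rewrite -ltnS; apply: leq_trans lek; rewrite ltnS.
    rewrite (bigD1 i) // [ltnRHS](bigD1 i) //=.
    rewrite xD eqxx -addSn leq_add //.
      by apply: leq_trans szj; rewrite ltn_modp.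
    by apply: leq_sum => l /negPf li; rewrite xD li.
  + apply/eqP => /matrixP/(_ 0 j); rewrite xD mxE eq_sym (negPf ij).
    exact/eqP.
  + by rewrite -mulmxA -map_mxM mulmxA E0E mul1mx.
  move=> E [E' [l [EE h]]]; exists (E *m (1%:M + D)), ((1%:M - D) *m E'), l.
  split; last by move=> q; rewrite -mulmxA.
  by rewrite mulmxA -(mulmxA _ E' E) EE mulmx1 E0E.
(* Sizes are totally ordered, so if no division is possible, [x] is nonzero only at [i], and row [i]
   of [map_mx pi U] vanishes in a domain. *)
- have /rV0Pn[i xi] := x0.
  exists 1%:M, 1%:M, i; split=> [|j]; first by rewrite mulmx1.
  rewrite mul1mx; move/matrixP/(_ 0 j): xU; rewrite !mxE (bigD1 i) //= big1.
    by rewrite mxE addr0 => /eqP; rewrite mulf_eq0 (negPf xi) => /eqP.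
  move=> l li; apply/eqP; rewrite mulf_eq0; apply/orP; left.
  apply: contraT => xl.
  case/orP: (leq_total (size (x 0%R i)) (size (x 0%R l))) => sz.
    by have := one (l, i); rewrite /= li xi sz.
  by have := one (i, l); rewrite /= eq_sym li xl sz.
Qed.

(** * Denominators and full-rank factorizations over K[t] *)

Lemma common_denominator (D : comPzRingType) (I : finType) (Q : D -> Prop)
    (P : I -> D -> Prop) :
  Q 1 -> (forall a b, Q a -> Q b -> Q (a * b)) ->
  (forall i a b, P i a -> P i (a * b)) ->
  (forall i, exists a, Q a /\ P i a) -> exists2 a, Q a & forall i, P i a.
Proof.
move=> Q1 QM PM /boolp.choice[f hf].
exists (\prod_i f i) => [|i]; first by apply: big_ind => // i _; case: (hf i).
by rewrite (bigD1 i) //=; apply: PM; case: (hf i).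
Qed.

Lemma fraction_denominator (D : idomainType) (y : {fraction D}) :
  exists d, d != 0 /\ exists x, tofrac x = tofrac d * y.
Proof.
elim/quotW: y => y; exists (\d_y); split; first exact: denom_ratioP.
exists (\n_y); rewrite -[_ * _]/(FracField.mul _ _) !piE.
apply/eqmodP; rewrite /= FracField.equivfE /FracField.mulf.
by rewrite !numden_Ratio ?(oner_eq0, mulf_neq0, denom_ratioP) // !mul1r mulrC.
Qed.

Lemma row_dependence (D : idomainType) r n (A : 'M[D]_(r, n)) :
  ~~ row_free (map_mx (@tofrac D) A) ->
  exists2 x : 'rV[D]_r, x != 0 & x *m A = 0.
Proof.
rewrite -kermx_eq0 => /rowV0Pn[y /sub_kermxP yA y0].
have [||||d d0 /boolp.choice[x hx]] := @common_denominator D 'I_r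
    (fun d => d != 0) (fun i d => exists x, tofrac x = tofrac d * y 0 i).
- exact: oner_neq0.
- exact: mulf_neq0.
- by move=> i a b [x xE]; exists (b * x); rewrite !tofracM xE mulrA [_ * tofrac a]mulrC.
- by move=> i; apply: fraction_denominator.
have xE : map_mx (@tofrac D) (\row_i x i) = tofrac d *: y.
  by apply/rowP => i; rewrite !mxE hx.
exists (\row_i x i).
  apply: contraNneq y0 => x0; move: xE; rewrite x0 map_mx0 => /esym/eqP.
  by rewrite scaler_eq0 tofrac_eq0 (negPf d0).
have : map_mx (@tofrac D) (\row_i x i *m A) = 0.
  by rewrite map_mxM xE -scalemxAl yA scaler0.
move=> xA; apply/rowP => j; move/rowP/(_ j): xA; rewrite mxE [RHS]mxE => /eqP.
by rewrite tofrac_eq0 [RHS]mxE => /eqP.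
Qed.

(** A dependence between the rows of [U] lets row reduction over K[t] create a zero row, which is
    deleted together with the matching column of the left factor. *)
Lemma shrink_factorization (K : fieldType) m n r
    (V : 'M[{poly K}]_(m, r)) (U : 'M[{poly K}]_(r, n)) :
  ~~ row_free (map_mx (@tofrac _) U) ->
  exists2 r', (r' < r)%N &
    exists (V' : 'M_(m, r')) (U' : 'M_(r', n)), V *m U = V' *m U'.
Proof.
move=> /row_dependence[x x0 xU].
have [||E [E' [i [E'E h]]]] := clear_row (pi := idfun) _ (U := U) x0.
- by move=> y; exists y.
- by rewrite map_mx_id.
case: r i => [[]//|r] i in V U E E' x x0 xU E'E h *.
exists r => //; exists (col' i (V *m E')), (row' i (E *m U)).
have {}h j : (E *m U) i j = 0 by exact: h.
rewrite -[X in X *m U]mulmx1 -E'E mulmxA -mulmxA.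
apply/matrixP => a b; rewrite mxE [RHS]mxE (bigD1_ord i) //= h mulr0 add0r.
by apply: eq_bigr => k _; congr (_ * _); rewrite [RHS]mxE.
Qed.

(** A factorization of least inner dimension works: a dependence in either factor would shrink it,
    for the left factor after transposition. *)
Lemma rank_factorization (K : fieldType) m n (M : 'M[{poly K}]_(m, n)) :
  exists r (V : 'M[{poly K}]_(m, r)) (U : 'M[{poly K}]_(r, n)),
  [/\ M = V *m U, row_free (map_mx (@tofrac _) U)
    & row_free (map_mx (@tofrac _) V^T)].
Proof.
pose fact r := `[< exists (V : 'M[{poly K}]_(m, r)) (U : 'M[{poly K}]_(r, n)),
  M = V *m U >].
have exf : exists r, fact r.
  by exists m; apply/asboolP; exists 1%:M, M; rewrite mul1mx.
have [r /asboolP[V [U MVU]] minr] := ex_minnP exf; exists r, V, U.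
split=> //; apply: contraT => /shrink_factorization fU.
  have [r' lt_r' [V' [U' E]]] := fU _ V.
  suff /minr : fact r' by rewrite leqNgt lt_r'.
  by apply/asboolP; exists V', U'; rewrite MVU.
have [r' lt_r' [V' [U' E]]] := fU _ U^T.
suff /minr : fact r' by rewrite leqNgt lt_r'.
apply/asboolP; exists U'^T, V'^T.
by rewrite -trmx_mul -E trmx_mul !trmxK.
Qed.

(** * Rank bounds by vanishing minors *)

Lemma det_thin_mul (D : idomainType) s r (A : 'M[D]_(s, r)) (B : 'M[D]_(r, s)) :
  (r < s)%N -> \det (A *m B) = 0.
Proof.
move=> ltrs; apply/eqP; rewrite -tofrac_eq0 -det_map_mx map_mxM.
apply: contraLR ltrs; rewrite -unitfE -unitmxE -row_free_unit -leqNgt.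
by move=> /eqP {1}<-; apply: leq_trans (mxrankM_maxr _ _) (rank_leq_row _).
Qed.

(** Rank at most [r], encoded by polynomial identities so that it passes along ring morphisms, in
    particular to reductions modulo a prime. *)
Definition minors_vanish (D : comPzRingType) m n (M : 'M[D]_(m, n)) r : Prop :=
  forall s (f : 'I_s -> 'I_m) (g : 'I_s -> 'I_n),
  (r < s)%N -> \det (mxsub f g M) = 0.

Lemma minors_vanish_mul (D : idomainType) m n r (a : D) (M : 'M[D]_(m, n))
    (V : 'M_(m, r)) (U : 'M_(r, n)) :
  a != 0 -> a *: M = V *m U -> minors_vanish M r.
Proof.
move=> a0 aM s f g ltrs; have := det_thin_mul (rowsub f V) (colsub g U) ltrs.
have -> : rowsub f V *m colsub g U = a *: mxsub f g M.
  by apply/matrixP => i j; move/matrixP/(_ (f i) (g j)): aM; rewrite !mxE => ->;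
    apply: eq_bigr => k _; rewrite !mxE.
by rewrite detZ => /eqP; rewrite mulf_eq0 expf_eq0 (negPf a0) andbF => /eqP.
Qed.

Lemma minors_vanish_rank (D : comPzRingType) (F : fieldType)
    (f : {rmorphism D -> F}) m n (M : 'M[D]_(m, n)) r :
  minors_vanish M r -> (\rank (map_mx f M) <= r)%N.
Proof.
move=> Mr; set A := map_mx f M; rewrite leqNgt; apply/negP => ltr.
(* A maximal independent set of rows, then of columns, gives an invertible submatrix whose size is
   the rank. *)
have Afull : row_full (rowsub (maxrankfun A) A)^T.
  by rewrite /row_full mxrank_tr; apply: maxrowsub_free.
have := mxrank_fullrowsub Afull.
set g := fullrankfun Afull => rkg.
have := Mr _ (maxrankfun A) g ltr.
move/(congr1 f); rewrite -det_map_mx map_mxsub rmorph0 -/A -det_tr => /eqP.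
apply/negP; rewrite -unitfE -unitmxE -row_free_unit /row_free -[X in _ == X]rkg.
by apply/eqP; congr (\rank _); apply/matrixP => i j; rewrite !mxE.
Qed.

(** The columns of [V] lie in the image of [M] and, by the rank bound, span it, so [M] factors
    through [V]. Hence y U V = 0 implies c y U = y U M = 0, and y = 0. *)
Lemma det_compression_neq0 (F : fieldType) n r (c : F) (M : 'M_n)
    (U : 'M_(r, n)) (V : 'M_(n, r)) :
  c != 0 -> (\rank M <= r)%N -> U *m M = c *: U -> M *m V = c *: V ->
  row_free U -> row_free V^T -> \det (U *m V) != 0.
Proof.
move=> c0 rkM UM MV fU fV.
have VM : (V^T <= M^T)%MS.
  apply/submxP; exists (c^-1 *: V^T).
  by rewrite -scalemxAl -trmx_mul MV linearZ /= scalerA mulVf ?scale1r.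
have /submxP[Y MT] : (M^T <= V^T)%MS.
  rewrite -(mxrank_leqif_sup VM) eqn_leq mxrankS //= mxrank_tr.
  by rewrite (eqP fV).
apply/negP => /det0P[y y0 yUV].
have : y *m (U *m M) = 0.
  by rewrite -[M]trmxK MT trmx_mul trmxK !mulmxA -(mulmxA y) yUV mul0mx.
rewrite UM -scalemxAr => /eqP; rewrite scaler_eq0 (negPf c0) /=.
by rewrite mulmx_free_eq0 // (negPf y0).
Qed.

(** * Dividing a determinant by a prime *)

Section ReductionModPrime.
Variables (q : nat) (q_prime : prime q).

Definition redq : {rmorphism {poly int} -> {poly 'F_q}} := map_poly intr.

Lemma redq_surj y : exists x, redq x = y.
Proof.
exists (\poly_(i < size y) (nat_of_ord (y`_i)%R)%:Z); apply/polyP => i.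
rewrite coef_map coef_poly; case: ltnP => [_|sz]; last by rewrite nth_default.
by rewrite /= -[_%:~R]/((nat_of_ord (y`_i)%R)%:R) natr_Zp.
Qed.

Lemma redq_eq0 x : redq x = 0 -> exists z, x = q%:Z *: z.
Proof.
move=> /polyP x0; exists (\poly_(i < size x) (x`_i %/ q%:Z)%Z).
apply/polyP => i; rewrite coefZ coef_poly; case: ltnP => sz; last first.
  by rewrite nth_default ?mulr0.
rewrite mulrC divzK // (dvdz_pcharf (pchar_Fp q_prime)).
by move: (x0 i); rewrite coef_map coef0 => ->.
Qed.

(** A dependence modulo [q] becomes, after an invertible row operation over Z[t], a row divisible by
    [q]. Dividing that row by [q] and applying the inverse operation to [V] removes one factor [q]
    from the determinant. *)
Lemma divide_row n r c (M : 'M_n) (U : 'M_(r, n)) (V : 'M_(n, r)) :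
  U *m M = c *: U -> M *m V = c *: V ->
  ~~ row_free (map_mx (@tofrac _) (map_mx redq U)) ->
  exists (U' : 'M_(r, n)) (V' : 'M_(n, r)),
  [/\ U' *m M = c *: U', M *m V' = c *: V'
    & \det (U *m V) = q%:R * \det (U' *m V')].
Proof.
move=> UM MV /row_dependence[x x0 xU].
have [E [E' [i [E'E h]]]] := clear_row redq_surj x0 xU.
have [z hz] := boolp.choice (fun j => redq_eq0 (h j)).
have q0 : q%:R != 0 :> {poly int}.
  by rewrite -polyC_natr polyC_eq0 natz; case: (q) q_prime.
pose d : 'rV[{poly int}]_r := \row_k (if k == i then q%:R else 1).
pose U' := \matrix_(k, j) if k == i then z j else (E *m U) k j.
have EU : E *m U = diag_mx d *m U'.
  apply/matrixP => k j; rewrite mul_diag_mx !mxE.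
  have [->|_] := eqVneq k i; last by rewrite mul1r.
  by have := hz j; rewrite mxE => ->; rewrite -mul_polyC -natz polyC_natr.
(* Cancelling [diag_mx d] carries the eigenvector relation from [E *m U] to [U']. *)
have d_inj (A : 'M_(r, n)) : diag_mx d *m A = 0 -> A = 0.
  move=> dA; apply/matrixP => k j; move/matrixP/(_ k j): dA.
  rewrite mul_diag_mx !mxE; case: eqP => _ /eqP; last by rewrite mul1r => /eqP.
  by rewrite mulf_eq0 (negPf q0) => /eqP.
exists U', (V *m E'); split.
- apply/eqP; rewrite -subr_eq0; apply/eqP/d_inj.
  by rewrite mulmxBr mulmxA -scalemxAr -EU -mulmxA UM -scalemxAr subrr.
- by rewrite mulmxA MV -scalemxAl.
have -> : q%:R = \det (diag_mx d).
  rewrite det_diag (bigD1 i) //= mxE eqxx big1 ?mulr1 // => k ki.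
  by rewrite mxE (negPf ki).
rewrite -det_mulmx !mulmxA -EU -[E *m U *m V]mulmxA det_mulmx mulrC.
by rewrite [\det (E *m _)]det_mulmx mulrA -det_mulmx E'E det1 mul1r.
Qed.

(** Modulo [q] the scalar [c] survives but the determinant vanishes, so by [det_compression_neq0]
    the rows of [U] or the columns of [V] become dependent; the second case is the first one for the
    transposes. *)
Lemma divide_det n r c (M : 'M_n) (U : 'M_(r, n)) (V : 'M_(n, r)) :
  minors_vanish M r -> redq c != 0 -> redq (\det (U *m V)) = 0 ->
  U *m M = c *: U -> M *m V = c *: V ->
  exists (U' : 'M_(r, n)) (V' : 'M_(n, r)),
  [/\ U' *m M = c *: U', M *m V' = c *: V'
    & \det (U *m V) = q%:R * \det (U' *m V')].
Proof.
move=> Mr c0 UV0 UM MV; pose f : {rmorphism _ -> _} := @tofrac {poly 'F_q} \o redq.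
have [fU|] := boolP (row_free (map_mx (@tofrac _) (map_mx redq U))); last first.
  exact: divide_row.
have [fV|fV] := boolP (row_free (map_mx (@tofrac _) (map_mx redq V^T))).
  suff : \det (map_mx f U *m map_mx f V) != 0.
    by rewrite -map_mxM det_map_mx /= UV0 rmorph0 eqxx.
  apply: (@det_compression_neq0 _ n r (f c) (map_mx f M)).
  - by rewrite /= tofrac_eq0.
  - exact: minors_vanish_rank.
  - by rewrite -map_mxM UM map_mxZ.
  - by rewrite -map_mxM MV map_mxZ.
  - by rewrite map_mx_comp.
  - by rewrite map_trmx map_mx_comp.
have [||V' [U' [VM' MU' dUV]]] := divide_row (c := c) (M := M^T) _ _ (V := U^T) fV.
- by rewrite -trmx_mul MV linearZ.
- by rewrite -trmx_mul UM linearZ.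
exists U'^T, V'^T; split.
- by apply: trmx_inj; rewrite trmx_mul trmxK MU' linearZ /= trmxK.
- by apply: trmx_inj; rewrite trmx_mul trmxK VM' linearZ /= trmxK.
by rewrite -trmx_mul det_tr -dUV -trmx_mul det_tr.
Qed.

End ReductionModPrime.

(** * Unimodular vectors for multiples of idempotents over Z[t] *)

Definition ZtoQ : {rmorphism {poly int} -> {poly rat}} := map_poly intr.

Lemma ZtoQ_inj : injective ZtoQ.
Proof. exact: (map_inj_poly intr_inj). Qed.

Lemma map_ZtoQ_inj m n : injective (map_mx ZtoQ : 'M_(m, n) -> 'M_(m, n)).
Proof.
move=> A B /matrixP AB; apply/matrixP => i j.
by move: (AB i j); rewrite !mxE => /ZtoQ_inj.
Qed.

Lemma integral_multiple m n (A : 'M[{poly rat}]_(m, n)) :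
  exists a (B : 'M[{poly int}]_(m, n)),
  (0 < a)%N /\ map_mx ZtoQ B = a%:R *: A.
Proof.
have [||||a a0 /boolp.choice[B hB]] := @common_denominator int ('I_m * 'I_n)%type
    (fun a => (0 < a)%R)
    (fun ij a => exists B, ZtoQ B = a%:~R * A ij.1 ij.2).
- exact: ltr01.
- by move=> a b; apply: mulr_gt0.
- by move=> ij a b [B BE]; exists (b%:~R * B);
    rewrite rmorphM BE rmorph_int intrM mulrA [_%:~R * _]mulrC.
(* The scalar [a] may be negative; its square is a positive denominator. *)
- move=> ij; have [p [a a0 E]] := rat_poly_scale (A ij.1 ij.2); exists (a ^+ 2).
  rewrite exprn_even_gt0 //=; split=> //; exists (a%:~R * p).
  have aE : a%:~R = (a%:~R : rat)%:P :> {poly rat} by rewrite rmorph_int.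
  rewrite rmorphM rmorph_int E rmorphXn /= aE -mul_polyC expr2 -mulrA.
  by congr (_ * _); rewrite mulrA -polyCM divff ?intr_eq0 // mul1r.
exists `|a|%N, (\matrix_(i, j) B (i, j)); split; first by rewrite absz_gt0 gt_eqF.
by apply/matrixP => i j; rewrite !mxE hB /= -[a in LHS]gtz0_abs.
Qed.

Section Unimodular.
Variables (n N k : nat) (N_gt0 : (0 < N)%N).
Variable M : 'M[{poly int}]_n.
Let c : {poly int} := N%:R * 'X^k.
Hypothesis MM : M *m M = c *: M.

(** A prime [q] not dividing [N] leaves c = N t^k nonzero modulo [q], so [divide_det] replaces [d]
    by d / q, and induction on [d] ends with divisors of powers of [N] only. *)
Lemma remove_primes r d j (U : 'M_(r, n)) (V : 'M_(n, r)) :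
  minors_vanish M r -> (0 < d)%N ->
  U *m M = c *: U -> M *m V = c *: V -> \det (U *m V) = d%:R * 'X^j ->
  exists d' (U' : 'M_(r, n)) (V' : 'M_(n, r)),
  [/\ (0 < d')%N, forall q, prime q -> (q %| d')%N -> (q %| N)%N,
    U' *m M = c *: U', M *m V' = c *: V' & \det (U' *m V') = d'%:R * 'X^j].
Proof.
move=> Mr; have [l] := ubnP d; elim: l d => // l IH d in U V *.
rewrite ltnS => ledl d0 UM MV UV.
have [/hasP[q]|/hasPn h] := boolP (has (fun q => ~~ (q %| N)%N) (primes d)).
  rewrite mem_primes => /and3P[pq _ /dvdnP[d' dE]] qN.
  have chq := pchar_Fp pq.
  have q0 : q%:R = 0 :> {poly 'F_q} by rewrite -polyC_natr (pcharf0 chq).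
  have [||U' [V' [UM' MV' dUV]]] := divide_det pq Mr _ _ UM MV.
  - rewrite rmorphM rmorph_nat rmorphXn /= map_polyX mulf_neq0 ?expf_neq0 ?polyX_eq0 //.
    by rewrite -polyC_natr polyC_eq0 -(dvdn_pcharf chq).
  - by rewrite UV rmorphM rmorph_nat dE natrM q0 mulr0 mul0r.
  have d'0 : (0 < d')%N by move: d0; rewrite dE; case: (d').
  apply: (IH d' U' V') => //.
    by apply: leq_trans ledl; rewrite dE ltn_Pmulr // prime_gt1.
  have qZ : q%:R != 0 :> {poly int}.
    by rewrite -polyC_natr polyC_eq0 natz; case: (q) pq.
  by apply: (mulfI qZ); rewrite -dUV UV dE natrM -mulrA mulrCA mulrA.
exists d, U, V; split=> // q pq qd; apply: contraT => qN.
have := h q; rewrite mem_primes pq d0 qd => /(_ isT).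
by rewrite qN.
Qed.

Lemma unimodular_poly : M != 0 ->
  exists (u : 'rV_n) (v : 'cV_n) d j,
  [/\ (0 < d)%N, forall q, prime q -> (q %| d)%N -> (q %| N)%N
    & u *m M *m v = (c * (d%:R * 'X^j))%:M].
Proof.
move=> M0; have [r [V [U [MVU fU fV]]]] := rank_factorization (map_mx ZtoQ M).
(* From M M = c M follows V (U V - c) U = 0, and both outer factors cancel over the fraction
   field. *)
have UV : U *m V = (ZtoQ c)%:M.
  have VXU : V *m (U *m V - (ZtoQ c)%:M) *m U = 0.
    rewrite mulmxBr mulmxBl !mulmxA -mulmxA -MVU -map_mxM MM map_mxZ.
    by rewrite mul_mx_scalar -scalemxAl -MVU subrr.
  have : map_mx (@tofrac _) (U *m V - (ZtoQ c)%:M) = 0.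
    move/(congr1 (map_mx (@tofrac _)))/eqP: VXU.
    rewrite !map_mxM map_mx0 mulmx_free_eq0 // -trmx_eq0 trmx_mul !map_trmx.
    rewrite mulmx_free_eq0 // => /eqP/matrixP X0; apply/matrixP => i j.
    by move: (X0 j i); rewrite !mxE.
  move=> /matrixP X0; apply/eqP; rewrite -subr_eq0; apply/eqP/matrixP => i j.
  by move: (X0 i j); rewrite mxE [RHS]mxE => /eqP; rewrite tofrac_eq0 [RHS]mxE => /eqP.
have [a [U1 [a0 hU]]] := integral_multiple U.
have [b [V1 [b0 hV]]] := integral_multiple V.
have UM1 : U1 *m M = c *: U1.
  apply: map_ZtoQ_inj; rewrite map_mxM map_mxZ hU MVU -scalemxAl mulmxA UV.
  by rewrite mul_scalar_mx scalerA mulrC -scalerA.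
have MV1 : M *m V1 = c *: V1.
  apply: map_ZtoQ_inj; rewrite map_mxM map_mxZ hV MVU -scalemxAr -mulmxA UV.
  by rewrite mul_mx_scalar scalerA mulrC -scalerA.
have VU1 : (a * b)%:R *: M = V1 *m U1.
  apply: map_ZtoQ_inj; rewrite map_mxM map_mxZ hU hV -scalemxAl -scalemxAr.
  by rewrite scalerA rmorph_nat natrM mulrC MVU.
have UV1 : U1 *m V1 = ((a * b)%:R * c)%:M.
  apply: map_ZtoQ_inj; rewrite map_mxM hU hV -scalemxAl -scalemxAr UV.
  rewrite map_scalar_mx [ZtoQ (_ * c)]rmorphM rmorph_nat scalerA natrM.
  by rewrite scale_scalar_mx.
have ab0 : (0 < a * b)%N by rewrite muln_gt0 a0.
have Mr : minors_vanish M r.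
  apply: minors_vanish_mul VU1.
  by rewrite -polyC_natr polyC_eq0 natz eqz_nat -lt0n.
(* [U1 *m V1] is the scalar matrix a b N t^k of size [r]; its determinant gives the initial [d] and
   [j]. *)
have [||d [U' [V' [d0 dN UM' MV' dUV]]]] :=
  remove_primes (d := (a * b * N) ^ r) (j := k * r) Mr _ UM1 MV1.
- by rewrite expn_gt0 muln_gt0 ab0 N_gt0.
- by rewrite UV1 det_scalar mulrA -natrM exprMn natrX exprM.
(* Inner dimension 0 would force M = 0; otherwise there is an index 0. *)
case: r => [|r] in V U MVU fU fV UV U1 hU V1 hV UM1 MV1 VU1 UV1 Mr U' V' UM' MV' dUV *.
  case/eqP: M0; apply: map_ZtoQ_inj; rewrite MVU map_mx0.
  by rewrite (flatmx0 U) mulmx0.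
(* Since U' M = c U', multiplying U' M V' by the adjugate of U' V' gives the scalar c det(U' V');
   the entry (0, 0) is kept. *)
exists (row 0 U'), (V' *m col 0 (\adj (U' *m V'))), d, (k * r.+1)%N; split=> //.
have E : (U' *m M *m V') *m \adj (U' *m V') = (c * \det (U' *m V'))%:M.
  by rewrite UM' -!scalemxAl mul_mx_adj scale_scalar_mx.
rewrite -row_mul mulmxA -row_mul -dUV; apply/matrixP => i l; rewrite !ord1.
by move/matrixP/(_ 0 0): E; rewrite !mxE => <-; apply: eq_bigr => q _; rewrite !mxE.
Qed.

End Unimodular.

(** * Transfer to the localized Laurent ring *)

Lemma ipolyK_zmod_morphism : zmod_morphism ipolyK.
Proof. by move=> x y; rewrite ipolyKD ipolyKN. Qed.

Lemma ipolyK_monoid_morphism : monoid_morphism ipolyK.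
Proof. by split=> [|x y]; rewrite ?ipolyK1 ?ipolyKM. Qed.
HB.instance Definition _ :=
  GRing.isZmodMorphism.Build {poly int} Qt ipolyK ipolyK_zmod_morphism.
HB.instance Definition _ :=
  GRing.isMonoidMorphism.Build {poly int} Qt ipolyK ipolyK_monoid_morphism.

Lemma ipolyK_inj : injective ipolyK.
Proof. by move=> x y /eqP; rewrite tofrac_eq => /eqP/ZtoQ_inj. Qed.

Lemma natQt_neq0 d : (0 < d)%N -> d%:R != 0 :> Qt.
Proof.
move=> d0; rewrite -(rmorph_nat (@tofrac {poly rat} \o polyC)) /= tofrac_eq0.
by rewrite polyC_eq0 pnatr_eq0 -lt0n.
Qed.

Section LocalizedLaurent.
Variable bad : nat -> Prop.

Definition Zloc_frac : {rmorphism Zloc bad -> Qt} := val : Zloc bad -> Qt.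

Lemma ipolyK_loc x : ipolyK x \in loc_pred bad.
Proof.
apply/asboolP; exists 1%N; split.
  by split=> // q pq; rewrite dvdn1 => /eqP q1; rewrite q1 in pq.
by apply/asboolP; exists (x, 0%N); rewrite /laurent_rep !mulr1.
Qed.

Definition poly_loc (x : {poly int}) : Zloc bad := MkZloc (ipolyK_loc x).

Lemma unit_loc d j : bad_nat bad d -> (d%:R * tK ^+ j)^-1 \in loc_pred bad.
Proof.
move=> bd; apply/asboolP; exists d; split=> //; apply/asboolP; exists (1, j).
have u0 : d%:R * tK ^+ j != 0.
  exact: mulf_neq0 (natQt_neq0 (proj1 bd)) (expf_neq0 j tK_neq0).
have E (F : fieldType) (a b : F) : a * b != 0 -> (a * b)^-1 * a * b = 1.
  by move=> ab0; rewrite -mulrA mulVf.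
rewrite /laurent_rep [RHS]ipolyK1; exact: E.
Qed.

Lemma loc_denominator (x : Zloc bad) : exists d,
  (exists N k, bad_nat bad N /\ d = N%:R * 'X^k) /\
  exists y, ipolyK y = ipolyK d * val x.
Proof.
case: x => x /= /asboolP[N [bN /asboolP[[y k] yE]]].
exists (N%:R * 'X^k); split; first by exists N, k.
by exists y; rewrite -yE ipolyKM ipolyKn ipolyKXn -mulrA mulrC.
Qed.

(** Clearing denominators turns [p] into an integral [M] with M M = c M, and the factor d t^j left
    by [unimodular_poly] is a unit of the localization. The conclusion says that the image of [p]
    has a unimodular element. *)
Lemma idempotent_unimodular n (p : 'M[Zloc bad]_n) : p *m p = p -> p != 0 ->
  exists (b : 'rV_n) (a : 'cV_n), b *m p *m a = 1%:M.
Proof.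
move=> pp p0.
have [||||_ [N [k [bN ->]]] /boolp.choice[m hm]] :=
  @common_denominator {poly int} ('I_n * 'I_n)%type
    (fun d => exists N k, bad_nat bad N /\ d = N%:R * 'X^k)
    (fun ij d => exists y, ipolyK y = ipolyK d * val (p ij.1 ij.2)).
- exists 1%N, 0%N; rewrite mulr1; split=> //; split=> // q pq.
  by rewrite dvdn1 => /eqP q1; rewrite q1 in pq.
- move=> _ _ [N [k [bN ->]]] [N' [k' [bN' ->]]].
  exists (N * N')%N, (k + k')%N; split; first exact: bad_natM.
  by rewrite natrM exprD mulrACA.
- by move=> ij a b [y yE]; exists (b * y);
    rewrite ipolyKM yE ipolyKM mulrA [_ * ipolyK a]mulrC.
- by move=> ij; apply: loc_denominator.
set c := _ * _ in hm; pose M := \matrix_(i, j) m (i, j).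
have ME : map_mx ipolyK M = ipolyK c *: map_mx Zloc_frac p.
  by apply/matrixP => i j; rewrite !mxE hm.
have map_inj k1 k2 : injective (map_mx ipolyK : 'M_(k1, k2) -> 'M_(k1, k2)).
  move=> A B /matrixP AB; apply/matrixP => i j.
  by move: (AB i j); rewrite !mxE => /ipolyK_inj.
have MM : M *m M = c *: M.
  apply: map_inj; rewrite map_mxM map_mxZ ME -scalemxAl -scalemxAr.
  by rewrite -map_mxM pp.
have N0 : (0 < N)%N by case: bN.
have c0 : ipolyK c != 0.
  rewrite ipolyKM ipolyKn ipolyKXn.
  exact: mulf_neq0 (natQt_neq0 N0) (expf_neq0 k tK_neq0).
have M0 : M != 0.
  apply: contraNneq p0 => M0; move: ME; rewrite M0 map_mx0 => /esym/eqP.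
  rewrite scaler_eq0 (negPf c0) => /eqP/matrixP p0; apply/eqP/matrixP => i j.
  by apply: val_inj; have := p0 i j; rewrite !mxE.
have [u [v [d [j [d0 dN uMv]]]]] := unimodular_poly N0 MM M0.
have bd : bad_nat bad d by split=> // q pq qd; case: bN => _; apply=> //; apply: dN.
exists (map_mx poly_loc u), (MkZloc (unit_loc j bd) *: map_mx poly_loc v).
have fE k1 k2 (A : 'M_(k1, k2)) :
    map_mx Zloc_frac (map_mx poly_loc A) = map_mx ipolyK A.
  by apply/matrixP => i l; rewrite !mxE.
have inj : injective (map_mx Zloc_frac : 'M_1 -> 'M_1).
  move=> A B /matrixP AB; apply/matrixP => i l; apply: val_inj.
  by have := AB i l; rewrite !mxE.
apply: inj; rewrite !map_mxM map_mxZ !fE map_mx1 -scalemxAr.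
move/(congr1 (map_mx ipolyK)): uMv.
rewrite !map_mxM map_scalar_mx ME -scalemxAr -scalemxAl /= ipolyKM.
rewrite -scale_scalar_mx.
move/(scalerI c0) => ->; rewrite scale_scalar_mx; congr (_%:M).
rewrite ipolyKM ipolyKn ipolyKXn.
exact: mulVf (mulf_neq0 (natQt_neq0 d0) (expf_neq0 j tK_neq0)).
Qed.

End LocalizedLaurent.
(** * Traces of finite projective modules *)

Definition linear_of (R : pzRingType) (M N : lmodType R) (f : M -> N)
    (fL : linear f) : {linear M -> N} :=
  HB.pack f (GRing.isLinear.Build R M N _ f fL).

(** The dual basis lemma: the [f i] are the components of a section of the surjection from the free
    module on the generators. *)
Lemma projective_coordinates (A : pzRingType) (M : lmodType A) n
    (x : 'I_n -> M) :
  projective M -> (forall m, exists c : 'I_n -> A, m = \sum_i c i *: x i) ->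
  exists f : 'I_n -> {linear M -> A^o}, forall m, m = \sum_i (f i m : A) *: x i.
Proof.
move=> Mproj Mgen; pose P : lmodType A := dsum (fun _ : 'I_n => A^o).
have gL : linear (fun c : P => \sum_i (c i : A) *: x i).
  move=> a c d; rewrite scaler_sumr -big_split; apply: eq_bigr => i _.
  exact: etrans (scalerDl _ _ _) (congr1 (+%R^~ _) (esym (scalerA _ _ _))).
have [m|k kE] := Mproj P M (linear_of gL) idfun.
  by have [c ->] := Mgen m; exists c.
have fL i : linear (fun m => k m i : A^o).
  by move=> a m m'; rewrite linearP.
by exists (fun i => linear_of (fL i)) => m; rewrite -[LHS]kE.
Qed.

Lemma gen_sum (A : pzRingType) (M : lmodType A) (s : seq M) m :
  gen (fun y => y \in s) m ->
  exists c : 'I_(size s) -> A, m = \sum_i c i *: s`_i.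
Proof.
move=> sm; apply: (sm (fun m => exists c : 'I_(size s) -> A,
    m = \sum_i c i *: s`_i)) => [|y ys];
  first split.
- by exists (fun=> 0); rewrite big1 // => i _; rewrite scale0r.
- move=> x y [c ->] [d ->]; exists (fun i => c i + d i).
  by rewrite -big_split; apply: eq_bigr => i _; rewrite scalerDl.
- move=> a x [c ->]; exists (fun i => a * c i).
  by rewrite scaler_sumr; apply: eq_bigr => i _; rewrite scalerA.
have iy : (index y s < size s)%N by rewrite index_mem.
exists (fun i => (i == Ordinal iy)%:R); rewrite (bigD1 (Ordinal iy)) //= eqxx.
by rewrite nth_index // scale1r big1 ?addr0 // => i /negPf ->; rewrite scale0r.
Qed.

Section DsumDelta.
Variables (A : pzRingType) (M : lmodType A) (I : finType).
Local Notation Ml := (dsum (fun _ : I => M)).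

Definition dsum_delta (i : I) (x : M) : Ml := fun j => if j == i then x else 0.

Lemma dsum_delta_linear i : linear (dsum_delta i).
Proof.
move=> a x y; apply: functional_extensionality_dep => j.
rewrite -[RHS]/(a *: dsum_delta i x j + dsum_delta i y j) /dsum_delta.
by case: (j == i); rewrite ?scaler0 ?addr0.
Qed.
HB.instance Definition _ i :=
  GRing.isLinear.Build A M Ml _ (dsum_delta i) (dsum_delta_linear i).

Lemma dsum_sumE (K : finType) (z : K -> Ml) i : (\sum_k z k) i = \sum_k z k i.
Proof. exact: (big_morph (fun z : Ml => z i)). Qed.

Lemma dsum_delta_sum (z : Ml) : z = \sum_i dsum_delta i (z i).
Proof.
apply: functional_extensionality_dep => j; rewrite dsum_sumE (bigD1 j) //=.
rewrite /dsum_delta eqxx big1 ?addr0 // => i /negPf ij.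
by rewrite eq_sym ij.
Qed.

End DsumDelta.

Section Trace.
Variable R : comNzRingType.
Implicit Types M N P : lmodType R.

(** [t] is the trace of the identity of the finite projective module [M],
    computed from a dual basis; over a domain it is the rank of [M]. *)
Definition has_trace M (t : R) : Prop :=
  exists (I : finType) (x : I -> M) (f : I -> {linear M -> R^o}),
  (forall m, m = \sum_i (f i m : R) *: x i) /\ t = \sum_i f i (x i).

Lemma has_trace_ord M t : has_trace M t ->
  exists n (x : 'I_n -> M) (f : 'I_n -> {linear M -> R^o}),
  (forall m, m = \sum_i (f i m : R) *: x i) /\ t = \sum_i f i (x i).
Proof.
move=> [I [x [f [xf ->]]]]; exists #|I|, (x \o enum_val), (fun i => f (enum_val i)).
have bij : {on [pred _ | true], bijective (@enum_val I (mem I))}.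
  by apply: onW_bij; apply: enum_val_bij.
split=> [m|]; last exact: (reindex _ bij).
exact: etrans (xf m) (reindex _ bij).
Qed.

(** Expanding each family of vectors in the other turns both traces into the same double sum. *)
Lemma has_trace_uniq M t u : has_trace M t -> has_trace M u -> t = u.
Proof.
move=> [I [x [f [xf ->]]]] [K [y [g [yg ->]]]].
transitivity (\sum_i \sum_k g k (x i) * f i (y k)).
  apply: eq_bigr => i _; rewrite {1}[x i]yg linear_sum.
  by apply: eq_bigr => k _; rewrite linearZ.
rewrite exchange_big; apply: eq_bigr => k _; rewrite {2}[y k]xf linear_sum.
by apply: eq_bigr => i _; rewrite linearZ /= -[_ *: _]/(_ * _) mulrC.
Qed.

(** Restricted functionals and projected vectors form a dual basis of the retract. The last clause
    covers isomorphisms, which preserve the trace. *)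
Lemma has_trace_retract M P (i : {linear M -> P}) (r : {linear P -> M}) t :
  cancel i r -> has_trace P t ->
  exists2 u, has_trace M u & (cancel r i -> u = t).
Proof.
move=> ir [I [x [f [xf ->]]]].
exists (\sum_k f k (i (r (x k)))) => [|ri]; last by apply: eq_bigr => k _; rewrite ri.
exists I, (r \o x), (fun k => f k \o i : {linear M -> R^o}); split=> // m.
by rewrite -[LHS]ir [i m]xf linear_sum; apply: eq_bigr => k _; rewrite linearZ.
Qed.

Lemma has_trace_iso M N t : lin_iso M N -> has_trace M t -> has_trace N t.
Proof.
move=> [f [g fg gf]] Mt.
have gL : linear g by apply: can2_linear fg gf.
by have [u Nu <-] := @has_trace_retract N M (linear_of gL) f t gf Mt.
Qed.

Lemma has_trace_dsum M (J : finType) t : has_trace M t ->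
  has_trace (dsum (fun _ : J => M)) (t *+ #|J|).
Proof.
move=> [I [x [f [xf ->]]]].
pose y (p : J * I) : dsum (fun _ : J => M) := dsum_delta p.1 (x p.2).
have gL (p : J * I) : linear (fun m : dsum (fun _ : J => M) => f p.2 (m p.1) : R^o).
  by move=> a m m'; rewrite linearP.
exists (J * I)%type, y, (fun p => linear_of (gL p)); split.
- move=> m; rewrite [LHS]dsum_delta_sum.
  rewrite -(pair_bigA _ (fun j i => (f i (m j) : R) *: y (j, i))) /=.
  apply: eq_bigr => j _; rewrite {1}[m j]xf linear_sum.
  by apply: eq_bigr => i _; rewrite linearZ.
- rewrite -(pair_bigA _ (fun j i => linear_of (gL (j, i)) (y (j, i)))) /= -sumr_const.
  by apply: eq_bigr => j _; apply: eq_bigr => i _; rewrite /y /= /dsum_delta eqxx.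
Qed.

(** The products of the two dual bases form a dual basis of the tensor product, with the lifts of
    the balanced maps [b] as functionals. *)
Lemma has_trace_tens (A : ralg R) (M : lmodType A) N t u :
  has_trace (under M) t -> has_trace N u -> has_trace (under (tens M N)) (t * u).
Proof.
move=> [I [x [f [xf ->]]]] [K [y [g [yg ->]]]].
pose b (p : I * K) (m : M) (n : N) : R^o := f p.1 m * g p.2 n.
have fr i r (m : M) : f i (ra_map A r *: m) = r * f i m.
  exact: (linearZZ (f i) r (m : under M)).
have bb p : balanced (b p).
  split=> [m m' n|m n n'|r m n]; rewrite /b.
  - by rewrite -mulrDl; congr (_ * _); apply: (raddfD (f p.1)).
  - by rewrite raddfD mulrDr.
  - by rewrite fr linearZ -mulrA mulrCA.
have hL p : linear (fun u : under (tens M N) => tlift (b p) u).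
  move=> r v w; rewrite (tliftD (bb p)); congr (_ + _).
  elim/tens_ind: v => [|m n|v v' hv hv'].
  - by rewrite scaler0 (tlift0 (bb p)) scaler0.
  - rewrite -[r *: _]/(ra_map A r *: tpure m n) tpureZ !tlift_pure //.
    by rewrite /b fr -mulrA.
  - by rewrite scalerDr !(tliftD (bb p)) hv hv' scalerDr.
exists (I * K)%type, (fun p => tpure (x p.1 : M) (y p.2)), (fun p => linear_of (hL p)).
split.
- elim/tens_ind => [|m n|v w hv hw].
  + by rewrite big1 // => p _; rewrite linear0 scale0r.
  + have mE : m = \sum_i ra_map A (f i m) *: (x i : M) := xf m.
    have fg_E i k : tlift (b (i, k)) (tpure m n) *: (tpure (x i : M) (y k) : under _)
        = tpure (ra_map A (f i m) *: (x i : M)) (g k n *: y k).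
      rewrite tlift_pure // -[LHS]/(ra_map A _ *: tpure (x i : M) (y k)).
      by rewrite tpureZ -tpure_map scalerA -rmorphM [g k n * _]mulrC.
    rewrite -(pair_bigA _ (fun i k => tlift (b (i, k)) (tpure m n) *:
      (tpure (x i : M) (y k) : under (tens M N)))) /=.
    rewrite {1}mE {1}[n]yg.
    rewrite (big_morph (fun z => tpure z _) (fun z z' => tpureDl z z' _) (id1 := 0)).
      apply: eq_bigr => i _.
      rewrite (big_morph (fun z => tpure _ z) (fun z z' => tpureDr _ z z') (id1 := 0)).
        by apply: eq_bigr => k _; rewrite fg_E.
      apply: (addrI (tpure (ra_map A (f i m) *: (x i : M)) 0)).
      by rewrite -tpureDr !addr0.
    by apply: (addrI (tpure (0 : M) (\sum_k g k n *: y k))); rewrite -tpureDl !addr0.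
  + by rewrite {1}hv {1}hw -big_split; apply: eq_bigr => p _; rewrite linearD scalerDl.
rewrite -(pair_bigA _ (fun i k => linear_of (hL (i, k)) (tpure (x i : M) (y k)))).
rewrite mulr_suml; apply: eq_bigr => i _; rewrite mulr_sumr; apply: eq_bigr => k _.
by rewrite /= tlift_pure.
Qed.

End Trace.

(** * Traces as ranks in characteristic zero *)

Lemma idempotent_trace (F : fieldType) n (p : 'M[F]_n) :
  p *m p = p -> \tr p = (\rank p)%:R.
Proof.
move=> pp; have := mulmx_base p.
set C := col_base p; set D := row_base p => CD.
have DC : D *m C = 1%:M.
  apply: (row_full_inj (col_base_full p)); apply: (row_free_inj (row_base_free p)).
  change (C *m (D *m C) *m D = C *m 1%:M *m D).
  by rewrite mulmx1 mulmxA -mulmxA CD pp.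
by rewrite -{1}CD mxtrace_mulC DC mxtrace1.
Qed.

Section TraceDomain.
Variables (R : comNzRingType) (F : fieldType) (iota : {rmorphism R -> F}).
Hypotheses (iota_inj : injective iota) (F_char0 : [pchar F] =i pred0).

(** The idempotent [p] cuts [M] out of a free module, so by [idempotent_trace] the trace is its
    rank. *)
Lemma has_trace_matrix (M : lmodType R) t : has_trace M t ->
  exists n (x : 'I_n -> M) (f : 'I_n -> {linear M -> R^o}),
  (forall m, m = \sum_i (f i m : R) *: x i) /\
  let p := \matrix_(i, j) iota (f i (x j)) in p *m p = p /\ \tr p = iota t.
Proof.
move=> /has_trace_ord[n [x [f [xf ->]]]]; exists n, x, f; split=> //=; split.
  apply/matrixP => i j; rewrite !mxE [x j in RHS]xf linear_sum rmorph_sum.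
  by apply: eq_bigr => k _; rewrite !mxE linearZ [RHS]rmorphM mulrC.
by rewrite rmorph_sum; apply: eq_bigr => i _; rewrite mxE.
Qed.

Lemma has_trace0 (M : lmodType R) : has_trace M 0 -> forall m : M, m = 0.
Proof.
move=> /has_trace_matrix[n [x [f [xf /= [pp]]]]].
rewrite (idempotent_trace pp) rmorph0 => /eqP.
have /pcharf0P -> := F_char0; rewrite mxrank_eq0 => /eqP p0 m.
have x0 j : x j = 0.
  rewrite [x j]xf big1 // => i _; move/matrixP/(_ i j): p0; rewrite !mxE.
  by rewrite -(rmorph0 iota) => /iota_inj ->; rewrite scale0r.
by rewrite [m]xf big1 // => i _; rewrite x0 scaler0.
Qed.

(** In rank one the values f_i(x_j) form a matrix C_i D_j, whose 2 by 2 minors vanish; this extends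
    linearly to all vectors and, through coordinates, to the functional [h]. *)
Lemma has_trace1 (M : lmodType R) (h : {linear M -> R^o}) (m m' : M) :
  has_trace M 1 -> (h m : R) *: m' = (h m' : R) *: m.
Proof.
move=> /has_trace_matrix[n [x [f [xf /= [pp]]]]].
set p := \matrix_(_, _) _ in pp *.
rewrite (idempotent_trace pp) rmorph1 => rk1.
have {}rk1 : \rank p = 1%N.
  have natF := (pcharf0P F).1 F_char0.
  case: (\rank p) rk1 => [/esym/eqP|r]; first by rewrite oner_eq0.
  by rewrite -addn1 natrD => /eqP; rewrite -subr_eq0 addrK natF => /eqP ->.
have minor i j k l : (f i (x j) : R) * f k (x l) = (f i (x l) : R) * f k (x j).
  apply: iota_inj; rewrite !rmorphM /=.
  have pE a b : iota (f a (x b)) = p a b by rewrite mxE.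
  rewrite !pE -(mulmx_base p); move: (col_base p) (row_base p); rewrite rk1 => C D.
  by rewrite !mxE !big_ord1 mulrACA [RHS]mulrACA [D 0 j * _]mulrC.
have minorl i k l a : (f i a : R) * f k (x l) = (f i (x l) : R) * f k a.
  rewrite [a in LHS]xf [a in RHS]xf !linear_sum mulr_suml mulr_sumr.
  by apply: eq_bigr => j _; rewrite !linearZ /= -mulrA minor mulrCA.
have minor2 i k a b : (f i a : R) * f k b = (f i b : R) * f k a.
  rewrite [b in LHS]xf [b in RHS]xf !linear_sum mulr_suml mulr_sumr.
  by apply: eq_bigr => j _; rewrite !linearZ /= mulrCA minorl mulrA.
have hE a : h a = \sum_k (f k a : R) * h (x k) :> R.
  by rewrite {1}[a]xf linear_sum; apply: eq_bigr => k _; rewrite linearZ.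
rewrite [m' in LHS]xf [m in RHS]xf !scaler_sumr; apply: eq_bigr => i _.
rewrite !scalerA; congr (_ *: _); rewrite !hE !mulr_suml; apply: eq_bigr => k _.
by rewrite mulrAC minor2 mulrAC.
Qed.

End TraceDomain.
(** * The idempotent generating Delta *)

Section IdempotentGenerator.
Variables (R : comNzRingType) (F : fieldType) (iota : {rmorphism R -> F}).
Hypotheses (iota_inj : injective iota) (F_char0 : [pchar F] =i pred0).
Hypothesis R_unimodular : forall n (p : 'M[R]_n), p *m p = p -> p != 0 ->
  exists (b : 'rV_n) (a : 'cV_n), b *m p *m a = 1%:M.
Variables (A B : ralg R) (pi : {rmorphism A -> B}).
Hypotheses (pi_surj : forall b, exists a, pi a = b)
  (pi_map : forall r, pi (ra_map A r) = ra_map B r).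
Variable J : B -> Prop.
Let JM : lmodType B := @subm B (regA B) J.
Hypotheses (B_finite : finite_module (under (regA B)))
  (B_proj : projective (under (regA B)))
  (J_ideal : is_ideal J) (J_proj : projective JM).
Variable e : B.
Hypotheses (ee : e * e = e) (Je : forall x, J x <-> igen (fun y => y = e) x).
Variables (De : lmodType A) (l : nat) (l_gt0 : (0 < l)%N).
Let Dl : lmodType A := dsum (fun _ : 'I_l => De).
Let BA : lmodType A := restr pi (regA B).
Variables (f : {linear (restr pi JM : lmodType A) -> Dl})
  (g : {linear Dl -> (restr pi JM : lmodType A)}).
Hypotheses (fg : cancel f g) (gf : cancel g f).
Hypothesis JM_tens : lin_iso (restr pi JM : lmodType A) (tens De (homR De BA)).

Lemma mem_J (b : regA B) : b \in gen_pred (M := regA B) J -> J b.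
Proof.
move=> /asboolP; apply=> //; case: J_ideal => J0 JD JL _.
by split=> // a x; apply: JL.
Qed.

Lemma Je_e : J e. Proof. by apply/Je => Y _; apply. Qed.

Definition toJ (b : B) (Jb : J b) : JM.
Proof. by apply: (@Subm B (regA B) J b); apply/asboolP => Y _; apply. Defined.

Definition phi_fun (i : 'I_l) (x : De) : BA := \val (g (dsum_delta i x) : JM).
Lemma phi_fun_linear i : linear (phi_fun i).
Proof. by move=> a x y; rewrite /phi_fun !linearP. Qed.
Definition phi (i : 'I_l) : {linear De -> BA} := linear_of (@phi_fun_linear i).

Lemma phi_J (h : 'I_l) x : J (phi h x : B).
Proof. by apply: mem_J; apply: valP. Qed.

Lemma phi_sum (y : JM) : \val y = \sum_i (phi i (f y i) : B) :> B.
Proof.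
rewrite -{1}[y]fg {1}[f y]dsum_delta_sum.
by rewrite [g _]linear_sum raddf_sum.
Qed.

Let i0 : 'I_l := Ordinal l_gt0.

Lemma phi_inj i : injective (phi i).
Proof.
move=> x y /val_inj/(congr1 f); rewrite !gf => /(congr1 (fun z : Dl => z i)).
by rewrite /dsum_delta eqxx.
Qed.

(** [De] embeds into [B] through [phi i0], and on [B] the algebra [A] acts through [pi]. *)
Lemma ker_pi a b (x : De) : pi a = pi b -> a *: x = b *: x.
Proof.
move=> ab; apply: (@phi_inj i0); rewrite !linearZ.
by rewrite -[LHS]/(pi a * _) ab.
Qed.

Definition pi_lift (b : B) : A := projT1 (boolp.choice pi_surj) b.
Lemma pi_liftK b : pi (pi_lift b) = b.
Proof. exact: (projT2 (boolp.choice pi_surj)). Qed.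

(** The action of [B] on [De] through lifts to [A]; it is well defined because
    [De] embeds into [B] as an [A]-module. *)
Definition act (b : B) (x : De) : De := pi_lift b *: x.

Lemma act_pi a x : act (pi a) x = a *: x.
Proof. by apply: ker_pi; rewrite pi_liftK. Qed.
Lemma actM b c x : act (b * c) x = act b (act c x).
Proof. by rewrite /act scalerA; apply: ker_pi; rewrite rmorphM !pi_liftK. Qed.
Lemma actDl b c x : act (b + c) x = act b x + act c x.
Proof. by rewrite /act -scalerDl; apply: ker_pi; rewrite rmorphD !pi_liftK. Qed.
Lemma actDr b x y : act b (x + y) = act b x + act b y.
Proof. exact: scalerDr. Qed.
Lemma act_map r x : act (ra_map B r) x = ra_map A r *: x.
Proof. by rewrite -pi_map act_pi. Qed.
Lemma act_suml (I : finType) (b : I -> B) x :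
  act (\sum_i b i) x = \sum_i act (b i) x.
Proof.
apply: (big_morph (act^~ x) (fun b c => actDl b c x)).
by rewrite -(rmorph0 pi) act_pi scale0r.
Qed.
Lemma act_scale b r x : act b (ra_map A r *: x) = ra_map A r *: act b x.
Proof. by rewrite -!act_map -!actM ra_central. Qed.
Lemma hom_map (h : {linear De -> BA}) r x :
  h (ra_map A r *: x) = ra_map B r * (h x : B) :> B.
Proof. by rewrite linearZ -pi_map. Qed.
Lemma hom_act (h : {linear De -> BA}) b x : h (act b x) = b * (h x : B) :> B.
Proof. by rewrite /act linearZ -[LHS]/(pi (pi_lift b) * _) pi_liftK. Qed.
Lemma end_act (h : {linear De -> De}) b x : h (act b x) = act b (h x).
Proof. exact: linearZ. Qed.

Lemma f_act b (y : JM) i : f (b *: y) i = act b (f y i).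
Proof.
rewrite /act -[RHS]/((pi_lift b *: f y) i) -linearZ.
by congr (f _ i); rewrite -[RHS]/(pi (pi_lift b) *: y) pi_liftK.
Qed.

(** [De] is a direct summand of the projective module [J], which is generated on the left by the
    elements e s_i. These are fixed by [e], hence so are their components in [De]. *)
Lemma dual_basis : exists n (x : 'I_n -> De) (psi : 'I_n -> {linear De -> BA}),
  (forall m, m = \sum_i act (psi i m) (x i)) /\ forall i, act e (x i) = x i.
Proof.
have [s sB] := B_finite.
have e_s i : J (e * s`_i).
  by case: J_ideal => _ _ _ JR; apply: JR; apply: Je_e.
pose z i : JM := toJ (e_s (i : 'I_(size s))).
(* The left combinations of the e s_i form a two-sided ideal containing [e]: each s_i a expands over
   the s_j with coefficients from [R], which are central. *)
have zgen m : exists c : 'I_(size s) -> B, m = \sum_i c i *: z i.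
  have [] := (Je (\val m)).1 (mem_J (valP m))
    (fun b => exists c : 'I_(size s) -> B, b = \sum_i c i * (e * s`_i)).
  - split.
    + by exists (fun=> 0); rewrite big1 // => i _; rewrite mul0r.
    + move=> b b' [c ->] [c' ->]; exists (fun i => c i + c' i).
      by rewrite -big_split; apply: eq_bigr => i _; rewrite mulrDl.
    + move=> a b [c ->]; exists (fun i => a * c i).
      by rewrite mulr_sumr; apply: eq_bigr => i _; rewrite mulrA.
    + move=> a b [c ->].
      have [d dE] : exists d : 'I_(size s) -> 'I_(size s) -> R,
          forall i : 'I_(size s), (s`_i : B) * a = \sum_j ra_map B (d i j) * (s`_j : B).
        have [d hd] := boolp.choice (fun i : 'I_(size s) => gen_sum (sB (s`_i * a))).
        by exists d => i; rewrite [LHS]hd.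
      exists (fun j => \sum_i c i * ra_map B (d i j)).
      under [RHS]eq_bigr => j _ do rewrite mulr_suml.
      rewrite exchange_big mulr_suml; apply: eq_bigr => i _ /=.
      rewrite -!mulrA dE !mulr_sumr; apply: eq_bigr => j _.
      by rewrite [e * (_ * _)]mulrA -ra_central -!mulrA.
  - move=> _ ->; have [c cE] := gen_sum (sB 1).
    exists (fun i => ra_map B (c i)); rewrite -[LHS]mulr1 [1]cE mulr_sumr.
    apply: eq_bigr => i _; rewrite -[c i *: _]/(ra_map B (c i) * _).
    by rewrite !mulrA ra_central.
  move=> c cE; exists c; apply: val_inj; rewrite raddf_sum cE.
  by apply: eq_bigr => i _.
have [sg sgE] := projective_coordinates J_proj zgen.
pose psi i (x : De) : BA := sg i (g (dsum_delta i0 x) : JM).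
have psiL i : linear (psi i).
  by move=> a x y; rewrite /psi !linearP.
exists (size s), (fun i => f (z i) i0), (fun i => linear_of (psiL i)); split.
- move=> m; have E := sgE (g (dsum_delta i0 m)).
  transitivity (f (g (dsum_delta i0 m)) i0); first by rewrite gf /dsum_delta eqxx.
  rewrite [X in f X]E [f _](raddf_sum f) dsum_sumE.
  by apply: eq_bigr => k _; apply: f_act.
- move=> i; rewrite -f_act; congr (f _ i0); apply: val_inj.
  by rewrite -[LHS]/(e * (e * s`_i)) mulrA ee.
Qed.

(** * Ranks of Delta, End(Delta) and Hom(Delta, B') *)

Let N : lmodType R := homR De BA.
Let C : lmodType R := homR De De.

Lemma under_lin_iso (M M' : lmodType A) : lin_iso M M' -> lin_iso (under M) (under M').
Proof.
move=> [h hbij].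
have hL : linear (h : under M -> under M').
  by move=> r x y; rewrite -[LHS]/(h (ra_map A r *: (x : M) + (y : M))) linearP.
by exists (linear_of hL).
Qed.

Lemma under_dsum t : has_trace (under De) t -> has_trace (under Dl) (t *+ l).
Proof.
move=> /(@has_trace_dsum _ _ 'I_l); rewrite card_ord; apply: has_trace_iso.
have idL : linear (id : dsum (fun _ : 'I_l => under De) -> under Dl) by [].
by exists (linear_of idL); exists id.
Qed.

(** The dual basis makes [De] an R-linear retract of a power of [B], which is finite projective over
    [R]. *)
Lemma trace_De : exists t, has_trace (under De) t.
Proof.
have [s sB] := B_finite.
have [bt bE] := projective_coordinates B_proj (fun m => gen_sum (sB m)).
have Bt : exists t, has_trace (under (regA B)) t.
  by eexists; exists 'I_(size s), (fun i : 'I_(size s) => s`_i), bt.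
have [t Btt] := Bt.
have [n [x [psi [xpsi _]]]] := dual_basis.
have iL : linear ((fun m i => psi i m) :
    under De -> dsum (fun _ : 'I_n => under (regA B))).
  move=> r m m'; apply: functional_extensionality_dep => i.
  rewrite -[LHS]/(psi i (ra_map A r *: (m : De) + (m' : De))).
  by rewrite linearD hom_map.
have rL : linear ((fun c => \sum_i act (c i) (x i)) :
    dsum (fun _ : 'I_n => under (regA B)) -> under De).
  move=> r c d; rewrite -[RHS]/(ra_map A r *: _ + _ : De).
  rewrite scaler_sumr -big_split; apply: eq_bigr => i _.
  rewrite -[LHS]/(act (ra_map B r * c i + d i) (x i)).
  by rewrite actDl actM act_map.
have ir : cancel (linear_of iL) (linear_of rL) by move=> m; rewrite [RHS]xpsi.
by have [u] := has_trace_retract ir (has_trace_dsum 'I_n Btt); exists u.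
Qed.

(** Evaluation at the [x i] embeds [C] into a power of [De]; the dual basis gives the retraction. *)
Lemma trace_C t : has_trace (under De) t -> exists t, has_trace C t.
Proof.
move=> Det; have [n [x [psi [xpsi _]]]] := dual_basis.
have iL : linear ((fun h i => (h : {linear De -> De}) (x i)) :
    C -> dsum (fun _ : 'I_n => under De)).
  by [].
have rL0 (c : dsum (fun _ : 'I_n => under De)) :
    linear ((fun m => \sum_i act (psi i m) (c i)) : De -> De).
  move=> a m m'; rewrite scaler_sumr -big_split; apply: eq_bigr => i _.
  rewrite linearP -[_ *: psi i m + _]/(pi a * (psi i m : B) + (psi i m' : B)).
  by rewrite actDl actM act_pi.
have rL : linear ((fun c => linear_of (rL0 c)) : dsum (fun _ : 'I_n => under De) -> C).
  move=> r c d; apply: HomP => m.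
  rewrite -[LHS]/(\sum_i act (psi i m) (ra_map A r *: (c i : De) + (d i : De))).
  rewrite -[RHS]/(ra_map A r *: (\sum_i act (psi i m) (c i)) +
    \sum_i act (psi i m) (d i)).
  rewrite scaler_sumr -big_split; apply: eq_bigr => i _.
  by rewrite actDr act_scale.
have ir : cancel (linear_of iL) (linear_of rL).
  move=> h; apply: HomP => m /=.
  rewrite [m in RHS]xpsi linear_sum; apply: eq_bigr => i _.
  by rewrite end_act.
by have [u] := has_trace_retract ir (has_trace_dsum 'I_n Det); exists u.
Qed.

(** As [e] fixes each x_i, h(x_i) = e h(x_i) lies in [J]. *)
Lemma hom_J (h : {linear De -> BA}) m : J (h m : B).
Proof.
have [n [x [psi [xpsi ex]]]] := dual_basis; case: J_ideal => J0 JD JL JR.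
rewrite [m]xpsi linear_sum; apply: (big_ind J) => // i _.
by rewrite hom_act -ex hom_act; apply: (JL); apply: (JR); apply: Je_e.
Qed.

(** By [hom_J], [N] is Hom(De, J), and the isomorphism of [J] with De^l identifies it with C^l. *)
Lemma trace_N t : has_trace C t -> has_trace N (t *+ l).
Proof.
move=> /(@has_trace_dsum _ _ 'I_l); rewrite card_ord; apply: has_trace_iso.
have hL0 (c : dsum (fun _ : 'I_l => C)) :
    linear ((fun m => \sum_i phi i ((c i : {linear De -> De}) m)) : De -> BA).
  move=> a m m'; rewrite scaler_sumr -big_split; apply: eq_bigr => i _.
  by rewrite !linearP.
have hL : linear ((fun c => linear_of (hL0 c)) : dsum (fun _ : 'I_l => C) -> N).
  move=> r c d; apply: HomP => m.
  rewrite -[LHS]/(\sum_i phi i (ra_map A r *: (c i : {linear De -> De}) m +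
    (d i : {linear De -> De}) m)).
  rewrite -[RHS]/(ra_map A r *: (\sum_i phi i ((c i : {linear De -> De}) m)) +
    \sum_i phi i ((d i : {linear De -> De}) m)).
  by rewrite scaler_sumr -big_split; apply: eq_bigr => i _; rewrite linearP.
exists (linear_of hL).
have kL0 (h : N) i :
    linear ((fun m => f (toJ (hom_J (h : {linear De -> BA}) m)) i) : De -> De).
  move=> a m m'; pose k m := toJ (hom_J (h : {linear De -> BA}) m) : restr pi JM.
  rewrite -[RHS]/((a *: f (k m) + f (k m')) i) -linearP; congr (f _ i).
  by apply: val_inj; rewrite /= linearP.
exists (fun h i => linear_of (kL0 h i)) => [c|h].
- apply: functional_extensionality_dep => i; apply: HomP => m.
  pose z : Dl := fun j => (c j : {linear De -> De}) m.
  rewrite -[LHS]/(f _ i) -[RHS]/(z i) -[z in RHS]gf; congr (f _ i).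
  by apply: val_inj; rewrite /= [RHS]phi_sum gf.
- apply: HomP => m; rewrite -[LHS]/(\sum_i _).
  by rewrite -[RHS]/(\val (toJ (hom_J (h : {linear De -> BA}) m))) phi_sum.
Qed.

Lemma iota_neq0 r : r != 0 -> iota r != 0.
Proof. by apply: contraNneq => r0; apply/eqP/iota_inj; rewrite r0 rmorph0. Qed.

Lemma End_scalar t (h : {linear De -> De}) : has_trace (under De) t -> t != 0 ->
  exists r, forall x, h x = ra_map A r *: x.
Proof.
move=> Det t0; have [c Ct] := trace_C Det.
(* The two descriptions of [J] give l t = t (l c); both [l] and [t] are nonzero in [F]. *)
have c1 : c = 1.
  have JMl : lin_iso Dl (restr pi JM) by exists g, f.
  have := has_trace_tens Det (trace_N Ct).
  have := has_trace_iso (under_lin_iso JM_tens)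
    (has_trace_iso (under_lin_iso JMl) (under_dsum Det)).
  move=> /has_trace_uniq/[apply] tl; apply: iota_inj.
  have il : l%:R != 0 :> F by rewrite ((pcharf0P F).1 F_char0) -lt0n.
  have it := iota_neq0 t0.
  apply: (mulfI it); apply: (mulIf il).
  rewrite rmorph1 mulr1 -!(rmorph_nat iota) -!rmorphM; congr (iota _).
  by rewrite !mulr_natr tl mulrnAr.
have [I [x [k [xk tr]]]] := Ct.
pose hx i : C := (h \o (x i : {linear De -> De}) : {linear De -> De}).
(* The scalar is the trace of composition with [h] on [C]. In rank one k_i(h x_i) id = k_i(id) h
   x_i, and the sum over i is [h] applied to the expansion of the identity. *)
exists (\sum_i k i (hx i)) => m.
rewrite -[RHS]/(((\sum_i k i (hx i) : R) *: (idfun : C) : {linear De -> De}) m).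
rewrite scaler_suml.
have -> : \sum_i (k i (hx i) : R) *: (idfun : C) = \sum_i (k i (idfun : C) : R) *: hx i.
  by apply: eq_bigr => i _; apply: (has_trace1 iota_inj F_char0); rewrite -c1.
have ev_sum (z : I -> C) : ((\sum_i z i : C) : {linear De -> De}) m =
    \sum_i (z i : {linear De -> De}) m.
  exact: (big_morph (fun w : C => (w : {linear De -> De}) m)).
rewrite ev_sum -[m in LHS]/((idfun : {linear De -> De}) m).
rewrite {1}[(idfun : C) in LHS]xk.
rewrite ev_sum linear_sum; apply: eq_bigr => i _.
by rewrite -[LHS]/(h (ra_map A _ *: (x i : {linear De -> De}) m)) linearZ.
Qed.

(** If [r] kills [De], then r t is the sum of the k_i(r x_i), which is 0, and [t] cancels in [F]. *)
Lemma trace_faithful t r : has_trace (under De) t -> t != 0 ->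
  (forall x : De, ra_map A r *: x = 0) -> r = 0.
Proof.
move=> [I [x [k [_ tE]]]] t0 r0; apply: iota_inj; rewrite rmorph0.
have it := iota_neq0 t0.
apply: (mulIf it); rewrite mul0r -rmorphM tE mulr_sumr big1 ?rmorph0 // => i _.
rewrite -[_ * _]/(r *: (k i (x i))) -linearZ.
by rewrite -[r *: x i]/(ra_map A r *: (x i : De)) r0 linear0.
Qed.

(** * From a pairing with value 1 to the idempotent *)

(** The idempotent is h(v), as h(v) h(v) = h(h(v) v) = h(v); right multiplication into [v] and [h]
    are inverse bijections between B h(v) and [De]. *)
Lemma generator_of_pairing (h : {linear De -> BA}) (v : De) :
  (forall x, act (h x) v = x) ->
  exists e1 : B, e1 * e1 = e1 /\
    lin_iso
      (restr pi (subm (fun y : regA B => exists x : B, y = x * e1 :> B)))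
      De.
Proof.
move=> hv; exists (h v : B).
have e1e1 : (h v : B) * (h v : B) = h v by rewrite -hom_act hv.
split=> //; set X := fun y : regA B => _.
have memX y : y \in gen_pred X -> exists x : B, y = x * (h v : B) :> B.
  move=> /asboolP/(_ X); apply=> //; split.
  - by exists 0; rewrite mul0r.
  - by move=> _ _ [x ->] [x' ->]; exists (x + x'); rewrite mulrDl.
  - by move=> a _ [x ->]; exists (a * x); rewrite -mulrA.
have hX x : (h x : B) \in gen_pred X.
  by apply/asboolP => Y _; apply; exists (h x : B); rewrite -hom_act hv.
have kL : linear ((fun y => act (\val (y : subm X)) v) : restr pi (subm X) -> De).
  move=> a y y'.
  rewrite -[LHS]/(act (pi a * (\val (y : subm X)) + \val (y' : subm X)) v).
  by rewrite actDl actM act_pi.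
exists (linear_of kL), (fun x => Subm (hX x)) => [y|x]; last exact: hv.
apply: val_inj; rewrite -[LHS]/(h (act (\val (y : subm X)) v) : B) hom_act.
by have [b ->] := memX _ (valP (y : subm X)); rewrite -mulrA e1e1.
Qed.

Lemma idempotent_generator :
  exists e1 : B, e1 * e1 = e1 /\
    lin_iso
      (restr pi (subm (fun y : regA B => exists x : B, y = x * e1 :> B)))
      De.
Proof.
have [t Det] := trace_De; have [t0|t0] := eqVneq t 0.
  (* Rank zero means [De] = 0, so the zero idempotent serves. *)
  apply: (@generator_of_pairing (\0 : {linear De -> BA}) 0) => x.
  rewrite t0 in Det; rewrite [RHS](has_trace0 iota_inj F_char0 Det).
  by rewrite /act scaler0.
pose v i := f (toJ Je_e) i.
have ve i : act e (v i) = v i.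
  by rewrite -f_act; congr (f _ i); apply: val_inj; rewrite -[LHS]/(e * e) ee.
have eE : e = \sum_i phi i (v i) by rewrite -phi_sum.
(* Each map from x to phi_i(x) v_j is an endomorphism of [De], hence a scalar: the entry (i, j) of
   [p]. *)
have ex_p (ij : 'I_l * 'I_l) : exists r, forall x,
    act (phi ij.1 x) (v ij.2) = ra_map A r *: x.
  have hL : linear ((fun x => act (phi ij.1 x) (v ij.2)) : De -> De).
    by move=> a x y; rewrite linearP actDl actM act_pi.
  exact: (End_scalar (linear_of hL) Det t0).
have [q qE] := boolp.choice ex_p; pose p := \matrix_(i, j) q (i, j).
have pE i j x : act (phi i x) (v j) = ra_map A (p i j) *: x.
  by rewrite mxE (qE (i, j)).
have vE j : v j = \sum_i ra_map A (p i j) *: v i.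
  rewrite -[LHS]ve {1}eE act_suml; apply: eq_bigr => i _; exact: pE.
have act_sumr b (K : finType) (z : K -> De) : act b (\sum_i z i) = \sum_i act b (z i).
  by rewrite /act scaler_sumr.
(* Expanding v_j by [vE] in phi_k(x) v_j gives the entry of p p acting on x, and [R] acts
   faithfully. *)
have pp : p *m p = p.
  apply/matrixP => k j; apply/eqP; rewrite -subr_eq0; apply/eqP.
  apply: (trace_faithful Det t0) => x.
  rewrite rmorphB scalerBl -pE {1}vE act_sumr [_ k j]mxE rmorph_sum scaler_suml.
  rewrite -sumrB big1 // => i _.
  by rewrite act_scale pE scalerA rmorphM ra_central subrr.
(* If p = 0 then all v_j vanish, hence also [e], [J] and [De], against t != 0. *)
have p0 : p != 0.
  apply/eqP => p0; have v0 j : v j = 0.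
    by rewrite vE big1 // => i _; rewrite p0 mxE rmorph0 scale0r.
  have e0 : e = 0 by rewrite eE big1 // => i _; rewrite v0 linear0.
  have /eqP := oner_neq0 R; apply; apply: (trace_faithful Det t0) => x.
  suff -> : x = 0 by rewrite scaler0.
  apply: (@phi_inj i0); rewrite linear0.
  apply: ((Je _).1 (phi_J i0 x) (fun y => y = 0)) => [|y ->//].
  split=> // [_ _ -> ->|a _ ->|a _ ->]; by rewrite ?addr0 ?mulr0 ?mul0r.
(* The combination of the phi_i with coefficients b_i, paired with that of the v_j with coefficients
   a_j, takes the value b p a = 1. *)
have [b [a bpa]] := R_unimodular pp p0.
have hL : linear ((fun x => \sum_i ra_map B (b 0 i) * (phi i x : B)) : De -> BA).
  move=> c x y; rewrite -[RHS]/(pi c * (\sum_i _) + \sum_i _) mulr_sumr -big_split.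
  apply: eq_bigr => i _; rewrite linearP.
  rewrite -[_ *: phi i x + _]/(pi c * (phi i x : B) + (phi i y : B)).
  by rewrite mulrDr mulrA ra_central -mulrA.
apply: (@generator_of_pairing (linear_of hL) (\sum_j ra_map A (a j 0) *: v j)) => x.
rewrite -[RHS]scale1r -(rmorph1 (ra_map A)).
have -> : 1 = \sum_j (\sum_i b 0 i * p i j) * a j 0.
  move/matrixP/(_ 0 0): bpa; rewrite !mxE eqxx => /esym ba; apply: (etrans ba).
  by apply: eq_bigr => j _; rewrite !mxE.
rewrite act_sumr rmorph_sum scaler_suml; apply: eq_bigr => j _.
rewrite act_scale -[linear_of hL x]/(\sum_i _) act_suml rmorphM -ra_central -scalerA.
congr (_ *: _); rewrite rmorph_sum scaler_suml; apply: eq_bigr => i _.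
by rewrite actM act_map pE scalerA rmorphM.
Qed.

End IdempotentGenerator.

(** * Application to the heredity chain *)

Lemma pchar_Qt : [pchar Qt] =i pred0.
Proof.
apply/pcharf0P => d; have [->|d0] := posnP d; first by rewrite eqxx.
by rewrite (negPf (natQt_neq0 d0)); case: d d0.
Qed.

Theorem corollary4p3p6
  (gT : finGroupType) (S : {set gT}) (L : gT -> nat)
  (W_standard : standard_coxeter S L)
  (W_not_2F4 : ~~ ([set: gT]%G \isog 'D_16))
  (D : kl_data S L)
  (ht : cell D -> nat) (ht_height : is_height ht)
  (X : cell D -> lmodType (RH D))
  (X_good : forall om : cell D, cell_J om = None -> good_X ht om (X om))
  (Y : asymp_data D)
  (s : nat) (d : 'I_s -> nat)
  (Lambda : forall i, mx_representation rat [set: gT] (d i))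
  (Lambda_irr : irr_family Lambda)
  (E : 'I_s -> lmodType (JZnat Y))
  (E_lattice : forall i, is_lattice (Lambda i) (E i))
  (I : nat -> Anat X -> Prop)
  (I_chain : ideal_chain I s)
  (I_refines : forall i, (i <= size (jvals ht))%N ->
    exists2 k, (k <= s)%N & forall x, I k x <-> Jideal_nat ht i x)
  (eps : nat -> 'I_s) (l : nat -> nat)
  (I_step : forall j, (0 < j <= s)%N ->
    good_step I j (l j) (Delta X (E (eps j)))) :
  forall j, (0 < j <= s)%N ->
  exists e1 : stepB I j, e1 * e1 = e1 /\
    lin_iso
      (infl (subm (fun y : regA (stepB I j) =>
               exists x : stepB I j, y = x * e1 :> stepB I j)))
      (Delta X (E (eps j))).
Proof.
move=> j js; have [[[Bfin Bproj] Jid [_ Jproj] _ _] _ [e [ee Je]]] := I_step _ js.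
move=> [l0 [f [g fg gf]]] Jtens.
have gL : linear g by apply: can2_linear fg gf.
have pi_surj (b : stepB I j) : exists a, quo_pi (I j.-1) a = b.
  by exists (repr b); apply: quo_piK.
(* Here R = Z^nat embeds in F = Q(t), and [pi] is the quotient map from A^{+nat} to B', compatible
   with scalars by definition. *)
exact: (idempotent_generator (iota := Zloc_frac (bad_prime D)) val_inj pchar_Qt
  (@idempotent_unimodular (bad_prime D)) pi_surj (fun=> erefl) Bfin Bproj Jid
  Jproj ee Je l0 (f := f) (g := linear_of gL) fg gf Jtens).
Qed.
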